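(* Let $s\in\mathbb{N}_+$ and $0<\alpha<1$. Let $f\in C^s[0,1]$ with $f(0),f(1)\in\mathbb{Z}$, and suppose that \[ \|(\widetilde{B}_n(f))^{(s)}-f^{(s)}\|=O(n^{-\alpha})\quad\text{or}\quad \|(\widehat{B}_n(f))^{(s)}-f^{(s)}\|=O(n^{-\alpha})\qquad (n\to\infty). \] Then \[ \omega_\varphi^2(f^{(s)},h)=O(h^{2\alpha})\quad\text{and}\quad \omega_1(f^{(s)},h)=O(h^{\alpha})\qquad (h\to 0+). \]
   Context: $\mathbb{N}_+=\{1,2,\dots\}$; $\|\cdot\|$ is the sup-norm on $[0,1]$; $C^s[0,1]$ is the space of real-valued $s$ times continuously differentiable functions on $[0,1]$. For $f\in C[0,1]$, $x\in[0,1]$ and $n\in\mathbb{N}_+$ define the (nonlinear) operators \[ \widetilde{B}_n(f)(x):=\sum_{k=0}^n \left[f\left(\tfrac{k}{n}\right)\binom{n}{k}\right]x^k(1-x)^{n-k},\qquad \widehat{B}_n(f)(x):=\sum_{k=0}^n \left\langle f\left(\tfrac{k}{n}\right)\binom{n}{k}\right\rangle x^k(1-x)^{n-k}, \] where $[a]$ is the largest integer less than or equal to the real $a$, and $\langle a\rangle$ is the nearest integer to $a$; if $a=m+1/2$ with $m\in\mathbb{Z}$, then $\langle a\rangle$ is set to be either $m$ or $m+1$ (the choice may depend on whether $m$ is positive or negative, even or odd), and the result holds regardless of the choice made. Moduli: with $\varphi(x):=\sqrt{x(1-x)}$, for $F\in C[0,1]$ and $t>0$, \[ \omega_\varphi^2(F,t):=\sup_{0<h\le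 t}\|\bar\Delta^2_{h\varphi}F\|, \] where $\bar\Delta^2_{h\varphi(x)}F(x):=F(x+h\varphi(x))-2F(x)+F(x-h\varphi(x))$ if $x\pm h\varphi(x)\in[0,1]$ and $:=0$ otherwise; and \[ \omega_1(F,t):=\sup_{|x-y|\le t,\ x,y\in[0,1]}|F(x)-F(y)|. \] The constants implicit in the $O$-symbols may depend on $f$. *)

(* Defs.v *)
From HB Require Import structures.
From mathcomp Require Import all_boot all_order all_algebra.
From mathcomp Require Import all_classical all_reals all_analysis.
Set Implicit Arguments.
Unset Strict Implicit.
Unset Printing Implicit Defensive.
Import Order.TTheory GRing.Theory Num.Theory.
Import numFieldNormedType.Exports.
Local Open Scope classical_set_scope.
Local Open Scope ring_scope.

(* Functions on [0, 1] are represented by functions R -> R; every definition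
   below only inspects the values on [0, 1]. *)

(* Difference quotients stay inside [0, 1], so that the derivatives at the
   endpoints are one-sided. *)
Definition diffquot01 {R : realType} (f : R -> R) (x : R) : set_system R :=
  (f y - f x) / (y - x) @[y --> within `[0, 1] x^'].

Definition derivable01 {R : realType} (f : R -> R) (x : R) : Prop :=
  cvg (diffquot01 f x).

Definition derive01 {R : realType} (f : R -> R) (x : R) : R :=
  lim (diffquot01 f x).

Definition derive01n {R : realType} (s : nat) (f : R -> R) : R -> R :=
  iter s derive01 f.

(* Continuity of the derivatives of order less than s is implied by their
   differentiability. *)
Definition C01 {R : realType} (s : nat) (f : R -> R) : Prop :=
  (forall i : nat, (i < s)%N ->
     forall x : R, x \in `[0, 1] -> derivable01 (derive01n i f) x) /\
  {within `[0, 1], continuous (derive01n s f)}.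

(* The real-valued [sup] is used throughout: the sets involved are nonempty,
   and bounded as soon as the functions are continuous on [0, 1]. *)
Definition supnorm01 {R : realType} (g : R -> R) : R :=
  sup [set `|g x| | x in `[0, 1]].

Definition bernstein_int {R : realType} (r : R -> int) (n : nat) (f : R -> R)
    (x : R) : R :=
  \sum_(k < n.+1)
    (r (f (k%:R / n%:R) * 'C(n, k)%:R))%:~R * x ^+ k * (1 - x) ^+ (n - k).

Definition bernstein_floor {R : realType} (n : nat) (f : R -> R) : R -> R :=
  bernstein_int (@Num.floor R) n f.

(* Each half-integer may be sent to either of its two nearest integers. *)
Definition nearest_int {R : realType} (r : R -> int) : Prop :=
  forall (a : R) (m : int), `|a - (r a)%:~R| <= `|a - m%:~R|.

Definition phi {R : realType} (x : R) : R := Num.sqrt (x * (1 - x)).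

Definition symdiff2 {R : realType} (F : R -> R) (h x : R) : R :=
  if (x + h * phi x \in `[0, 1]) && (x - h * phi x \in `[0, 1])
  then F (x + h * phi x) - 2 * F x + F (x - h * phi x)
  else 0.

Definition omega2phi {R : realType} (F : R -> R) (t : R) : R :=
  sup [set supnorm01 (symdiff2 F h) | h in `]0, t]].

Definition omega1 {R : realType} (F : R -> R) (t : R) : R :=
  sup [set `|F p.1 - F p.2| | p in
        [set p : R * R | [/\ p.1 \in `[0, 1], p.2 \in `[0, 1]
                            & `|p.1 - p.2| <= t]]].

(* Main.v *)
(** Write [F] for the derivative of order [s] of [f], [T n] for the rounded
    Bernstein polynomial, [B n] for the Bernstein operator and
    [E n = B n f - T n], whose coefficient in front of [x ^ k (1 - x) ^ (n - k)]
    is at most 1 in absolute value.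

    The Bernstein coefficients of the derivative of order [s] of [E n] are
    O(1/n), except possibly for the first and the last [s + 1] of them, because
    'C(n, j) >= c n ^ (s + 1) away from the end points.  The extreme ones can be
    recovered by interpolation from the values of that derivative at points
    within O(1/n) of the end points.  There a polynomial [g] satisfies
    |(B n g)^(s) - g^(s)| <= (C / n) (|g^(s)| + |g^(s+1)|) in sup-norms, so
    comparing [f] with [g = T N], [N <= n], bounds all these coefficients by
    C (N ^ -alpha + |(T N)^(s+1)| / n).

    In T n = B n (f - T N) + B n (T N) - E n the first term gains a factor [n]
    per derivative of order one (or per two derivatives, with the weight
    [x (1 - x)]), while [B n] is bounded for the seminorms |g^(s+1)| and
    |x (1 - x) g^(s+2)|.  Both seminorms [theta n] of [T n] therefore satisfy
    theta n <= K theta N + C n N ^ -alpha for all N <= n, whence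
    theta n = O(n ^ (1 - alpha)).  Both moduli follow by comparing [F] with
    (T n)^(s) for [n] about 1/h, respectively 1/h^2. *)
Require Import Defs.
From mathcomp Require Import all_boot all_order all_algebra.
From mathcomp Require Import all_classical all_reals all_analysis.
From mathcomp Require Import ring lra zify.
Set Implicit Arguments.
Unset Strict Implicit.
Unset Printing Implicit Defensive.
Import Order.TTheory GRing.Theory Num.Theory.
Import numFieldNormedType.Exports.
Local Open Scope classical_set_scope.
Local Open Scope ring_scope.

(** * Bernstein polynomials *)

Definition bernp {R : comNzRingType} (m k : nat) : {poly R} :=
  'C(m, k)%:R *: ('X^k * (1 - 'X) ^+ (m - k)).

Definition bern {R : comNzRingType} (m : nat) (c : nat -> R) : {poly R} :=
  \sum_(k < m.+1) c k *: bernp m k.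

Definition fdiff {R : zmodType} (c : nat -> R) (k : nat) : R := c k.+1 - c k.

Section BernsteinAlgebra.
Context {R : comNzRingType}.
Implicit Types (m k i : nat) (c : nat -> R).

Lemma bernp_small m k : (m < k)%N -> bernp m k = 0 :> {poly R}.
Proof. by move=> mk; rewrite /bernp bin_small// scale0r. Qed.

Lemma sum_bernp m : \sum_(k < m.+1) bernp m k = 1 :> {poly R}.
Proof.
rewrite -[RHS](expr1n _ m) -[in RHS](subrK 'X 1) exprDn.
apply: eq_bigr => k _.
by rewrite /bernp scaler_nat [X in X *+ _]mulrC.
Qed.

Lemma eq_bern m c1 c2 : (forall k, (k <= m)%N -> c1 k = c2 k) ->
  bern m c1 = bern m c2.
Proof. by move=> e; apply: eq_bigr => k _; rewrite e// -ltnS. Qed.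

Lemma bern_cst m (a : R) : bern m (fun=> a) = a%:P.
Proof. by rewrite /bern -scaler_sumr sum_bernp alg_polyC. Qed.

Lemma bernD m c1 c2 : bern m (fun k => c1 k + c2 k) = bern m c1 + bern m c2.
Proof. by rewrite -big_split; apply: eq_bigr => k _; rewrite scalerDl. Qed.

Lemma bernN m c : bern m (fun k => - c k) = - bern m c.
Proof. by rewrite -sumrN; apply: eq_bigr => k _; rewrite scaleNr. Qed.

Lemma bernB m c1 c2 : bern m (fun k => c1 k - c2 k) = bern m c1 - bern m c2.
Proof. by rewrite -bernN -bernD. Qed.

Lemma bernZ m a c : bern m (fun k => a * c k) = a *: bern m c.
Proof. by rewrite scaler_sumr; apply: eq_bigr => k _; rewrite scalerA. Qed.

Lemma horner_bernp m k (x : R) :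
  (bernp m k).[x] = 'C(m, k)%:R * x ^+ k * (1 - x) ^+ (m - k).
Proof. by rewrite /bernp !hornerE. Qed.

Lemma horner_bern m c (x : R) :
  (bern m c).[x] = \sum_(k < m.+1) c k * (bernp m k).[x].
Proof. by rewrite horner_sum; apply: eq_bigr => k _; rewrite hornerZ. Qed.

Lemma bernp_rev m k (x : R) : (k <= m)%N ->
  (bernp m k).[1 - x] = (bernp m (m - k)).[x].
Proof.
by move=> km; rewrite !horner_bernp bin_sub// subKr subKn// mulrAC.
Qed.

Lemma bern_rev m c (x : R) :
  (bern m c).[1 - x] = (bern m (fun k => c (m - k)%N)).[x].
Proof.
rewrite !horner_bern (reindex_inj rev_ord_inj)/=.
by apply: eq_bigr => k _; rewrite subSS bernp_rev ?leq_subr// subKn// -ltnS.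
Qed.

Lemma deriv_subX_exp j : ((1 - 'X) ^+ j)^`() = - (j%:R *: (1 - 'X) ^+ j.-1) :> {poly R}.
Proof.
by rewrite deriv_exp derivB derivX derivC sub0r mulN1r scaler_nat mulNrn.
Qed.

Lemma deriv_bernp0 m : (bernp m.+1 0)^`() = - (m.+1%:R *: bernp m 0) :> {poly R}.
Proof. by rewrite /bernp !bin0 !scale1r !expr0 !mul1r deriv_subX_exp !subn0. Qed.

Lemma deriv_bernpS m k :
  (bernp m.+1 k.+1)^`() = m.+1%:R *: (bernp m k - bernp m k.+1) :> {poly R}.
Proof.
rewrite /bernp derivZ derivM derivXn deriv_subX_exp subSS /=.
rewrite scalerDr scalerBr !scalerA -!natrM mulrnAl -scaler_nat scalerA -natrM.
rewrite mulnC mul_bin_diag; congr (_ + _).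
rewrite mulrN scalerN -scalerAr scalerA -natrM mulnC -subSS -mul_bin_down.
by rewrite subSS subnS.
Qed.

Lemma deriv_bern m c : (bern m.+1 c)^`() = m.+1%:R *: bern m (fdiff c).
Proof.
rewrite /bern linear_sum big_ord_recl /= derivZ deriv_bernp0 /=.
under eq_bigr => k _ do rewrite derivZ deriv_bernpS.
have -> : \sum_(k < m.+1) fdiff c k *: bernp m k =
    \sum_(k < m.+1) c k.+1 *: bernp m k - \sum_(k < m.+2) c k *: bernp m k :> {poly R}.
  rewrite [X in _ - X]big_ord_recr /= bernp_small// scaler0 addr0 -sumrB.
  by apply: eq_bigr => k _; rewrite scalerBl.
rewrite [X in _ - X]big_ord_recl /= scalerBr scalerDr opprD addrCA; congr (_ + _).
  by rewrite scalerN !scalerA [c _ * _]mulrC.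
rewrite -scalerBr -sumrB scaler_sumr; apply: eq_bigr => k _.
by rewrite -scalerBr !scalerA mulrC.
Qed.

Lemma derivn_bern i m c :
  (bern (i + m) c)^`(i) = ((i + m) ^_ i)%:R *: bern m (iter i fdiff c).
Proof.
elim: i c => [|i IH] c; first by rewrite derivn0 scale1r.
rewrite derivSn addSn deriv_bern derivnZ IH scalerA -natrM -iterSr.
by rewrite ffactSS.
Qed.

(* The identity [x (1 - x) p' = (k - m x) p] for the basis polynomials replaces
   the explicit computation of the moments of the binomial distribution. *)
Lemma deriv_bernp_mul m k : (k <= m)%N ->
  'X * (1 - 'X) * (bernp m k)^`() = (k%:R - m%:R * 'X) * bernp m k :> {poly R}.
Proof.
move=> km; rewrite /bernp derivZ -!scalerAr; congr (_ *: _).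
have {2}-> : m = (k + (m - k))%N by rewrite subnKC.
move: (m - k)%N => j; rewrite derivM derivXn deriv_subX_exp scaler_nat natrD.
case: k {km} => [|k]; case: j => [|j] /=; rewrite ?exprS; ring.
Qed.

Lemma sum_bernp_moment1 m :
  \sum_(k < m.+1) (k%:R - m%:R * 'X) * bernp m k = 0 :> {poly R}.
Proof.
under eq_bigr => k _ do rewrite -deriv_bernp_mul ?leq_ord//.
have := congr1 (fun p => 'X * (1 - 'X) * p^`()) (sum_bernp m).
by rewrite linear_sum derivC mulr0 mulr_sumr.
Qed.

(** Applying [X (1 - X) d/dX] to the vanishing first moment multiplies each term by another
    [k - m X] and subtracts [m X (1 - X)] times the partition of unity. *)
Lemma sum_bernp_moment2 m :
  \sum_(k < m.+1) (k%:R - m%:R * 'X) ^+ 2 * bernp m k =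
  m%:R * ('X * (1 - 'X)) :> {poly R}.
Proof.
have e k : (k < m.+1)%N -> ('X * (1 - 'X)) * ((k%:R - m%:R * 'X) * bernp m k)^`() =
    (k%:R - m%:R * 'X) ^+ 2 * bernp m k - m%:R * ('X * (1 - 'X)) * bernp m k :> {poly R}.
  move=> km; rewrite derivM mulrDr [X in _ + X]mulrCA deriv_bernp_mul//.
  rewrite derivB -!polyC_natr derivM !derivC derivX; ring.
have := congr1 (fun p => 'X * (1 - 'X) * p^`()) (sum_bernp_moment1 m).
rewrite linear_sum /= derivC mulr0 mulr_sumr (eq_bigr _ (fun (k : 'I_m.+1) _ => e k (ltn_ord k))).
by rewrite sumrB -mulr_sumr sum_bernp mulr1 => /eqP; rewrite subr_eq0 => /eqP.
Qed.

(** The operator [X (1 - X) d/dX] is applied to the first-order identity, which is then substituted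
    back; two derivatives become a quadratic factor in [k - m X]. *)
Lemma deriv2_bernp_mul m k : (k <= m)%N ->
  ('X * (1 - 'X)) ^+ 2 * (bernp m k)^`(2) =
  ((k%:R - m%:R * 'X) ^+ 2 - (1 - 2 * 'X) * (k%:R - m%:R * 'X)
   - m%:R * ('X * (1 - 'X))) * bernp m k :> {poly R}.
Proof.
move=> km; have h := deriv_bernp_mul km.
have := congr1 (fun p => 'X * (1 - 'X) * p^`()) h.
rewrite !derivM !derivB derivM -!polyC_natr !derivC derivX -derivn1 -derivnS.
rewrite !polyC_natr derivn1 => h2.
have -> : ('X * (1 - 'X)) ^+ 2 * (bernp m k)^`(2) =
   'X * (1 - 'X) * ((1 * (1 - 'X) + 'X * (0 - 1)) * (bernp m k)^`() +
     'X * (1 - 'X) * (bernp m k)^`(2)) -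
   (1 - 2 * 'X) * ('X * (1 - 'X) * (bernp m k)^`()) :> {poly R} by ring.
rewrite h2 mulrDr [X in _ + X - _]mulrCA h; ring.
Qed.

End BernsteinAlgebra.

(** * Sup-norm and weighted bounds for Bernstein polynomials *)

Section BernsteinBounds.
Context {R : realFieldType}.
Implicit Types (m k i : nat) (c b : nat -> R) (x M : R).

Lemma bernp_ge0 m k x : 0 <= x <= 1 -> 0 <= (bernp m k).[x].
Proof.
move=> /andP[x0 x1]; rewrite horner_bernp !mulr_ge0 ?exprn_ge0 ?subr_ge0//.
Qed.

Lemma ler_norm_bern m c b x : 0 <= x <= 1 ->
  (forall k, (k <= m)%N -> `|c k| <= b k) ->
  `|(bern m c).[x]| <= (bern m b).[x].
Proof.
move=> x01 cb; rewrite !horner_bern; apply: le_trans (ler_norm_sum _ _ _) _.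
apply: ler_sum => k _; rewrite normrM (ger0_norm (bernp_ge0 _ _ x01)).
by rewrite ler_wpM2r ?bernp_ge0// cb// -ltnS.
Qed.

Lemma norm_bern_le m c x M : 0 <= x <= 1 ->
  (forall k, (k <= m)%N -> `|c k| <= M) -> `|(bern m c).[x]| <= M.
Proof. by move=> x01 /(ler_norm_bern x01); rewrite bern_cst hornerC. Qed.

Lemma norm_iter_fdiff i c k M : (forall j, (k <= j <= k + i)%N -> `|c j| <= M) ->
  `|iter i fdiff c k| <= 2 ^+ i * M.
Proof.
elim: i k => [|i IH] k h; first by rewrite expr0 mul1r h// addn0 leqnn.
rewrite iterS /fdiff exprS -mulrA mulr_natl mulr2n.
apply: le_trans (ler_normB _ _) _; apply: lerD; apply: IH => j /andP[kj jk]; apply: h.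
  by rewrite (ltnW kj) addnS -addSn.
by rewrite kj (leq_trans jk)// addnS.
Qed.

Lemma bern0 c : bern 0 c = (c 0%N)%:P.
Proof. by rewrite /bern big_ord1 /bernp !expr0 mulr1 scale1r alg_polyC. Qed.

Lemma norm_deriv_bern_le m c x M : 0 <= x <= 1 ->
  (forall k, (k <= m)%N -> `|c k| <= M) ->
  `|(bern m c)^`().[x]| <= 2 * m%:R * M.
Proof.
case: m => [|m] x01 cM.
  by rewrite bern0 derivC horner0 normr0 mulr0 mul0r.
rewrite deriv_bern hornerZ normrM normr_nat [2 * _]mulrC -mulrA ler_wpM2l//.
apply: norm_bern_le => // k km; rewrite -[2]expr1.
by apply: (norm_iter_fdiff (i := 1)) => j /andP[_ jk]; rewrite cM// (leq_trans jk)// addn1.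
Qed.

Lemma horner_moment2 m x :
  (bern m (fun k => (k%:R - m%:R * x) ^+ 2)).[x] = m%:R * (x * (1 - x)).
Proof.
have := congr1 (fun p => p.[x]) (sum_bernp_moment2 (R := R) m).
rewrite horner_sum -!polyC_natr !hornerE => <-.
by rewrite horner_bern; apply: eq_bigr => k _; rewrite -!polyC_natr !hornerE.
Qed.

(** The inequality [2 |t| <= 1 + t ^ 2] replaces Cauchy-Schwarz. The loss is harmless where it is
    applied: [m x (1 - x)] is compared with 1 there, from above or from below. *)
Lemma horner_abs_moment_le m x : 0 <= x <= 1 ->
  (bern m (fun k => `|k%:R - m%:R * x|)).[x] <= (1 + m%:R * (x * (1 - x))) / 2.
Proof.
move=> x01; pose sq k := (k%:R - m%:R * x) ^+ 2.
have -> : (1 + m%:R * (x * (1 - x))) / 2 = (bern m (fun k => 2^-1 * (1 + sq k))).[x].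
  by rewrite bernZ bernD bern_cst hornerZ hornerD hornerC horner_moment2 mulrC.
apply: le_trans (ler_norm _) _; apply: ler_norm_bern => // k _.
rewrite normr_id /sq; set t := _ - _; rewrite -(real_normK (num_real t)).
by have := sqr_ge0 (`|t| - 1); rewrite !expr2; nra.
Qed.

(** Two regimes. If [m x (1 - x) <= 1], the weight absorbs one factor [m] of the crude bound
    [4 m ^ 2 M]. Otherwise [deriv2_bernp_mul] expresses the derivative through moments, each
    controlled by [v = m x (1 - x) > 1]. *)
Lemma phi_deriv2_bern_le m c x M : 0 <= x <= 1 ->
  (forall k, (k <= m)%N -> `|c k| <= M) ->
  x * (1 - x) * `|(bern m c)^`(2).[x]| <= 4 * m%:R * M.
Proof.
move=> x01 cM; have M0 : 0 <= M by rewrite (le_trans _ (cM 0%N _)).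
have p0 : 0 <= x * (1 - x) by case/andP: x01 => *; rewrite mulr_ge0 ?subr_ge0.
have [small|large] := leP (m%:R * (x * (1 - x))) 1.
  have cdd : `|(bern m c)^`(2).[x]| <= m%:R * (4 * m%:R * M).
    case: m cM small => [|[|m]] cM _.
    - by rewrite bern0 derivnC horner0 normr0 mul0r.
    - by rewrite derivnS derivn1 deriv_bern bern0 derivZ derivC scaler0 horner0 normr0
        mul1r mulr1 mulr_ge0.
    - rewrite -[m.+2]/(2 + m)%N derivn_bern hornerZ normrM normr_nat.
      have -> : m.+2%:R * (4 * m.+2%:R * M) = (m.+2 * m.+2)%:R * (2 ^+ 2 * M).
        by rewrite natrM; ring.
      rewrite ler_pM//; first by rewrite ler_nat !ffactnS ffactn0 muln1 leq_mul.
      apply: norm_bern_le => // k km.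
      apply: norm_iter_fdiff => j /andP[_ jk]; apply: cM.
      by rewrite (leq_trans jk)// addnC leq_add2l.
  apply: le_trans (ler_wpM2l p0 cdd) _.
  by rewrite mulrCA mulrA ler_piMl// !mulr_ge0.
have ppos : 0 < x * (1 - x).
  by rewrite lt_neqAle p0 andbT eq_sym; apply/eqP => e; move: large; rewrite e mulr0 ltr10.
rewrite -(ler_pM2l ppos) mulrA -expr2.
rewrite -[X in X * _]ger0_norm ?sqr_ge0// -normrM.
pose d k := k%:R - m%:R * x.
pose q k := d k ^+ 2 - (1 - 2 * x) * d k - m%:R * (x * (1 - x)).
have -> : (x * (1 - x)) ^+ 2 * (bern m c)^`(2).[x] = (bern m (fun k => c k * q k)).[x].
  rewrite /bern (raddf_sum (derivn 2)) !horner_sum mulr_sumr; apply: eq_bigr => k _.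
  have := congr1 (fun p => p.[x]) (deriv2_bernp_mul (R := R) (leq_ord k)).
  move: (bernp m k) => p; rewrite -!polyC_natr !hornerE => h.
  rewrite -[X in _ * X.[x] = _]/((c k *: p)^`(2)) derivnZ !hornerZ mulrCA.
  by rewrite h /q /d /=; ring.
pose b k := M * (d k ^+ 2 + `|d k| + m%:R * (x * (1 - x))).
apply: le_trans (ler_norm_bern (b := b) x01 _) _.
  move=> k km; rewrite normrM ler_pM ?cM// /q.
  apply: le_trans (ler_normB _ _) (lerD _ _); last by rewrite ger0_norm ?(mulr_ge0 _ p0).
  apply: le_trans (ler_normB _ _) (lerD _ _); first by rewrite ger0_norm ?sqr_ge0.
  by rewrite normrM ler_piMl// ler_norml; case/andP: x01 => *; apply/andP; split; lra.
rewrite bernZ !bernD bern_cst hornerZ !hornerD hornerC horner_moment2.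
have := horner_abs_moment_le m x01; rewrite -/(d _).
set A := horner _ _; set v := m%:R * _ => hA.
have -> : x * (1 - x) * (4 * m%:R * M) = M * (4 * v) by rewrite /v; ring.
by rewrite ler_wpM2l//; move: large; rewrite -/v; lra.
Qed.

End BernsteinBounds.

(** * Coefficients of the rounding error *)

(** Both products equal the trinomial coefficient [(r + a + b)! / (r! a! b!)]. *)
Lemma bin_trinomial (r a b : nat) :
  ('C(r + a + b, r + a) * 'C(r + a, r) = 'C(r + a + b, r) * 'C(a + b, a))%N.
Proof.
have h1 := bin_fact (leq_addr b (r + a)%N).
have h2 := bin_fact (leq_addr a r).
have h3 : ('C(r + a + b, r) * (r`! * (a + b)`!) = (r + a + b)`!)%N.
  by rewrite -addnA -[X in (_ * (_ * X`!))%N](addKn r) bin_fact// leq_addr.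
have h4 := bin_fact (leq_addr b a).
rewrite !addKn in h1 h2 h4.
apply/eqP; rewrite -(eqn_pmul2r (_ : 0 < r`! * a`! * b`!)%N) ?muln_gt0 ?fact_gt0//.
apply/eqP; transitivity ((r + a + b)`!)%N.
  by rewrite -h1 -h2; ring.
by rewrite -h3 -h4; ring.
Qed.

(** After multiplication by ['C(r + a, r)] the trinomial identity reduces the claim to
    ['C(r + a, a) <= 'C(a + b, a)], monotonicity in the upper index. *)
Lemma leq_bin_mid (r a b : nat) : (r <= b)%N ->
  ('C(r + a + b, r) <= 'C(r + a + b, r + a))%N.
Proof.
move=> rb; have p : (0 < 'C(r + a, r))%N by rewrite bin_gt0 leq_addr.
rewrite -(leq_pmul2r p) bin_trinomial leq_mul2l; apply/orP; right.
by rewrite -bin_sub ?leq_addr// addKn leq_bin2l// addnC leq_add2l.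
Qed.

Lemma leq_expn_ffact (n r : nat) : ((n - r) ^ r <= n ^_ r)%N.
Proof.
elim: r n => [//|r IH] [|n]; first by rewrite sub0n exp0n.
rewrite subSS ffactSS expnS leq_mul ?(leq_trans _ (IH n))// (leq_trans (leq_subr _ _))//.
Qed.

Lemma leq_expnl (a b r : nat) : (a <= b)%N -> (a ^ r <= b ^ r)%N.
Proof. by case: r => // r; rewrite leq_exp2r. Qed.

Lemma leq_ffact_expn (n r : nat) : (n ^_ r <= n ^ r)%N.
Proof.
elim: r n => [//|r IH] [|n]; first by rewrite exp0n.
rewrite ffactSS expnS leq_mul// (leq_trans (IH n))//.
exact: leq_expnl.
Qed.

Lemma leq_expn_bin (n r : nat) : (r.*2 <= n)%N ->
  (n ^ r <= 2 ^ r * r`! * 'C(n, r))%N.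
Proof.
move=> rn; rewrite -mulnA [(r`! * _)%N]mulnC bin_ffact.
apply: leq_trans (leq_mul (leqnn _) (leq_expn_ffact n r)).
rewrite -expnMn leq_expnl//; lia.
Qed.

(** * Recovery of coefficients from values near an end point *)

Section Interpolation.
Context {R : realFieldType}.

(** The Vandermonde matrix of the nodes 0, ..., s is invertible, and the absolute sum of the entries
    of its inverse serves as a constant depending on [s] alone. *)
Lemma coef_interpolation_bound (s : nat) : exists2 C : R, 0 <= C &
  forall (e : nat -> R) (eta : R),
    (forall i, (i <= s)%N -> `|\sum_(k < s.+1) e k * i%:R ^+ k| <= eta) ->
    forall k, (k <= s)%N -> `|e k| <= C * eta.
Proof.
pose a : 'rV[R]_s.+1 := \row_j (j : nat)%:R.
pose V := Vandermonde s.+1 a.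
have Vu : V \in unitmx.
  rewrite unitmxE det_Vandermonde unitfE; apply/prodf_neq0 => i _.
  apply/prodf_neq0 => j ij; rewrite !mxE subr_eq0 eqr_nat.
  by rewrite gt_eqF.
exists (\sum_(i < s.+1) \sum_(k < s.+1) `|invmx V i k|).
  by apply: sumr_ge0 => i _; apply: sumr_ge0.
move=> e eta he k ks.
pose r := \row_(j < s.+1) e j.
have eta0 : 0 <= eta by rewrite (le_trans _ (he 0%N _)).
have -> : e k = r 0 (Ordinal (ks : (k < s.+1)%N)) by rewrite mxE.
rewrite -[r](mulmxK Vu) mxE; apply: le_trans (ler_norm_sum _ _ _) _.
rewrite mulr_suml; apply: ler_sum => i _.
rewrite normrM mulrC; apply: ler_pM => //.
  by rewrite (bigD1 (Ordinal (ks : (k < s.+1)%N)))//= lerDl sumr_ge0.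
rewrite mxE; under eq_bigr => j _ do rewrite !mxE.
exact: he (leq_ord i).
Qed.

End Interpolation.

Section EndCoefficients.
Context {R : realFieldType}.
Implicit Types (x z : R) (m k s : nat).

Lemma bernoulli_ineq m z : 0 <= z <= 1 -> 1 - m%:R * z <= (1 - z) ^+ m.
Proof.
move=> /andP[z0 z1]; elim: m => [|m IH]; first by rewrite mul0r subr0 expr0.
rewrite exprS -subr_ge0 -natr1.
have : 0 <= (1 - z) * ((1 - z) ^+ m - (1 - m%:R * z)) by rewrite mulr_ge0 ?subr_ge0.
have : 0 <= m%:R * z * z by rewrite !mulr_ge0.
by lra.
Qed.

(** The product of [(1 + z) ^ m] and [(1 - z) ^ m] is at most 1, and the second factor is at least
    1/2 by Bernoulli's inequality. *)
Lemma exp1D_le2 m z : 0 <= z -> 2 * m%:R * z <= 1 -> (1 + z) ^+ m <= 2.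
Proof.
move=> z0 mz; case: m mz => [|m] mz; first by rewrite expr0 ler1n.
have z1 : z <= 1.
  apply: le_trans mz; rewrite -[leLHS]mul1r ler_wpM2r//.
  by rewrite -natrM ler1n.
have h : 2^-1 <= (1 - z) ^+ m.+1.
  by apply: le_trans (bernoulli_ineq m.+1 (_ : 0 <= z <= 1)); [lra | rewrite z0].
have : (1 + z) ^+ m.+1 * (1 - z) ^+ m.+1 <= 1.
  rewrite -exprMn exprn_ile1 ?mulr_ge0 ?subr_ge0 ?addr_ge0//.
  by have := sqr_ge0 z; rewrite expr2; lra.
have : 0 <= (1 + z) ^+ m.+1 * ((1 - z) ^+ m.+1 - 2^-1).
  by rewrite mulr_ge0 ?subr_ge0 ?exprn_ge0 ?addr_ge0.
by lra.
Qed.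

(* On [0, 1/(2m)] the substitution [z = x / (1 - x)] turns the first [s + 1]
   basis polynomials into monomials in [m z], up to bounded factors. *)
Lemma bern_head_coef_bound s : exists2 C : R, 0 <= C &
  forall m (D : nat -> R) eta, (0 < m)%N -> (s.*2 <= m)%N ->
    (forall x, 0 <= x <= (2 * m%:R)^-1 ->
      `|\sum_(k < s.+1) D k * (bernp m k).[x]| <= eta) ->
    forall k, (k <= s)%N -> `|D k| <= C * eta.
Proof.
have [C0 C00 hC0] := coef_interpolation_bound (R := R) s.
(* [G] bounds the quotients [T ^ k / 'C(m, k)], [k <= s], that lead from the monomial coefficients
   [e k] back to [D k]. *)
pose G : R := (s.+1.*2 ^ s * (2 ^ s * s`!))%:R.
exists (G * (C0 * 2)); first by rewrite !mulr_ge0.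
move=> m D eta m0 sm hD k ks.
have eta0 : 0 <= eta.
  by rewrite (le_trans _ (hD 0 _))// lexx invr_ge0 mulr_ge0.
have mR0 : 0 < m%:R :> R by rewrite ltr0n.
(* With this scale the sample points [z = i / T], [i <= s], satisfy [2 m z <= 1]: then
   [(1 + z) ^ m <= 2], and [x <= z] stays in the interval covered by [hD]. *)
pose T : R := (s.+1.*2 * m)%:R.
have T0 : 0 < T by rewrite ltr0n muln_gt0 m0.
pose e j := D j * 'C(m, j)%:R / T ^+ j.
have he i : (i <= s)%N -> `|\sum_(j < s.+1) e j * i%:R ^+ j| <= 2 * eta.
  move=> ile; pose z : R := i%:R / T.
  have z0 : 0 <= z by rewrite mulr_ge0 ?invr_ge0 // ltW.
  have z1 : 0 < 1 + z by rewrite ltr_wpDr.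
  have mz : 2 * m%:R * z <= 1.
    rewrite /z mulrA ler_pdivrMr// mul1r -!natrM ler_nat; nia.
  pose x := z / (1 + z).
  have xz : x <= z by rewrite ler_pdivrMr// ler_peMr// lerDl.
  have x0 : 0 <= x by rewrite mulr_ge0 ?invr_ge0// ltW.
  have e1x : 1 - x = (1 + z)^-1 by rewrite /x; field; rewrite gt_eqF.
  have -> : \sum_(j < s.+1) e j * i%:R ^+ j =
      (1 + z) ^+ m * \sum_(j < s.+1) D j * (bernp m j).[x].
    rewrite mulr_sumr; apply: eq_bigr => j _; rewrite horner_bernp e1x /e /x.
    have -> : D j * 'C(m, j)%:R / T ^+ j * i%:R ^+ j = D j * 'C(m, j)%:R * z ^+ j.
      by rewrite /z expr_div_n mulrAC mulrA.
    move: (1 + z) z1 => w w0; rewrite (expr_div_n z w) exprVn.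
    have -> : w ^+ m = w ^+ j * w ^+ (m - j).
      by rewrite -exprD subnKC//; have := ltn_ord j; lia.
    have := expf_neq0 j (lt0r_neq0 w0); have := expf_neq0 (m - j) (lt0r_neq0 w0).
    by move: (w ^+ j) (w ^+ (m - j)) (z ^+ j) => u v t v0 u0; field; rewrite u0 v0.
  rewrite normrM ger0_norm ?exprn_ge0 ?(ltW z1)//; apply: ler_pM => //.
  - by rewrite exprn_ge0 ?(ltW z1).
  - exact: exp1D_le2.
  - apply: hD; rewrite x0 (le_trans xz)// -[_^-1]mul1r ler_pdivlMr ?mulr_gt0//.
    by rewrite mulrC.
have cm0 : 0 < 'C(m, k)%:R :> R by rewrite ltr0n bin_gt0; lia.
have -> : D k = (T ^+ k / 'C(m, k)%:R) * e k.
  by rewrite /e; field; rewrite !gt_eqF// ?exprn_gt0.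
rewrite normrM -mulrA ler_pM//; last by rewrite -mulrA; exact: hC0.
rewrite ger0_norm ?divr_ge0 ?exprn_ge0 ?(ltW T0)//.
rewrite ler_pdivrMr// -natrX -natrM ler_nat expnMn -mulnA leq_mul//.
  by rewrite leq_pexp2l.
apply: leq_trans (leq_expn_bin (n := m) (r := k) _) _; first by lia.
by rewrite leq_mul// leq_mul ?leq_pexp2l// leq_fact.
Qed.
End EndCoefficients.

(** * Middle coefficients and the far tail of the differentiated rounding error *)

Section RoundingCoefficients.
Context {R : realFieldType}.
Implicit Types (x : R) (a : nat -> R) (m k s : nat).

Lemma norm_ffact_iter_fdiff_le s m a k M :
  (forall j, (k <= j <= k + s)%N -> `|a j| <= M) ->
  `|((s + m) ^_ s)%:R * iter s fdiff a k| <= ((s + m) ^ s * 2 ^ s)%:R * M.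
Proof.
move=> /norm_iter_fdiff h; rewrite normrM normr_nat natrM -mulrA ler_pM//.
  by rewrite ler_nat leq_ffact_expn.
by rewrite natrX.
Qed.

(** All indices [j] entering the difference keep distance at least [s + 1] from both ends, so
    ['C(n, j) >= 'C(n, s + 1)], which is of order [n ^ (s + 1)]. The falling factorial costs only
    [n ^ s], and a factor of order [1 / n] remains. *)
Lemma mid_coef_bound s m a k : (s.+2 <= m)%N ->
  (forall j, (j <= s + m)%N -> `|a j| * 'C(s + m, j)%:R <= 1) ->
  (s < k)%N -> (k + s < m)%N ->
  `|((s + m) ^_ s)%:R * iter s fdiff a k| <=
    (2 ^ s * 2 ^ s.+1 * s.+1`!)%:R / m%:R.
Proof.
move=> sm ha sk km; set n := (s + m)%N.
have c0 : 0 < 'C(n, s.+1)%:R :> R by rewrite ltr0n bin_gt0 /n; lia.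
have aj j : (k <= j <= k + s)%N -> `|a j| <= 'C(n, s.+1)%:R^-1.
  move=> /andP[kj jk]; rewrite -[_^-1]mul1r ler_pdivlMr//.
  apply: le_trans (ha j _); last by lia.
  rewrite ler_wpM2l// ler_nat.
  have := @leq_bin_mid s.+1 (j - s.+1) (n - j).
  have -> : (s.+1 + (j - s.+1) = j)%N by lia.
  by rewrite subnKC; [apply|]; rewrite /n; lia.
apply: le_trans (norm_ffact_iter_fdiff_le m aj) _.
rewrite ler_pdivrMr// mulrAC ler_pdivlMr ?ltr0n; last by lia.
rewrite -!natrM ler_nat.
have := leq_expn_bin (n := n) (r := s.+1); rewrite -/n => h.
have {}h : (n ^ s.+1 <= 2 ^ s.+1 * s.+1`! * 'C(n, s.+1))%N by apply: h; rewrite /n; lia.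
apply: (@leq_trans (n ^ s.+1 * 2 ^ s)%N).
  by rewrite mulnAC expnSr leq_mul2r /n leq_mul2l leq_addl !orbT.
by rewrite mulnC (leq_trans (leq_mul (leqnn _) h))// !mulnA.
Qed.

(** For [k >= m - s >= 2 s + 2] the power [x ^ k] is at most [m ^ -(2 s + 2)], against a binomial
    coefficient of at most [m ^ s]. The sum outweighs coefficients of order [m ^ s] and still leaves
    a factor [1 / m]. *)
Lemma tail_bound s m x : (3 * s + 2 <= m)%N -> 0 <= x <= (2 * m%:R)^-1 ->
  (bern m (fun k => (m - s <= k)%N%:R)).[x] <= 2 / (m ^ s.+1)%:R.
Proof.
move=> sm /andP[x0 xm].
have m0 : 0 < m%:R :> R by rewrite ltr0n; lia.
have m1 : 1 <= m%:R :> R by rewrite ler1n; lia.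
have xm1 : x <= m%:R^-1.
  by apply: le_trans xm _; rewrite lef_pV2 ?posrE ?mulr_gt0// ler_peMl// ?ler1n// ltW.
have im1 : (m%:R^-1 : R) <= 1 by rewrite invf_le1.
have x1 : x <= 1 by apply: le_trans im1.
have e : (m ^ s)%:R * (m%:R^-1) ^+ (s.*2.+2) = (m ^ s.+2)%:R^-1 :> R.
  rewrite !natrX -addnn -addn2 -addnA exprD mulrA exprVn mulfV ?mul1r ?expf_neq0 ?gt_eqF//.
  by rewrite addn2 exprVn.
apply: (@le_trans _ _ (\sum_(k < m.+1) (m ^ s.+2)%:R^-1)).
  rewrite horner_bern; apply: ler_sum => k _; case: leqP => km; last first.
    by rewrite mul0r invr_ge0.
  rewrite mul1r horner_bernp -e -[leRHS]mulr1 ler_pM ?exprn_ge0 ?subr_ge0 ?mulr_ge0 ?exprn_ge0//.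
    apply: ler_pM; rewrite ?exprn_ge0//.
      rewrite ler_nat -bin_sub ?leq_ord//.
      apply: (@leq_trans (m ^ (m - k))%N); last by rewrite leq_pexp2l; lia.
      apply: leq_trans (leq_ffact_expn m (m - k)).
      by rewrite -bin_ffact leq_pmulr ?fact_gt0.
    apply: (@le_trans _ _ (m%:R^-1 ^+ k)).
      by apply: lerXn2r; rewrite // nnegrE invr_ge0 ltW.
    apply: ler_wiXn2l; rewrite ?invr_ge0 ?(ltW m0)//; lia.
  by apply: exprn_ile1; rewrite ?subr_ge0//; lra.
rewrite sumr_const card_ord -[X in X <= _]mulr_natl ler_pdivlMr ?ltr0n ?expn_gt0; last first.
  by apply/orP; left; lia.
rewrite (expnS m s.+1) natrM invfM.
have mm0 : (m ^ s.+1)%:R != 0 :> R by rewrite pnatr_eq0 -lt0n expn_gt0; apply/orP; left; lia.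
rewrite mulrA divfK// ler_pdivrMr// -natrM ler_nat; lia.
Qed.

End RoundingCoefficients.

(** * All coefficients of the differentiated rounding error *)

Section ErrorCoefficients.
Context {R : realFieldType}.
Implicit Types (x : R) (a : nat -> R) (m k s : nat).

(** Near 0 the first [s + 1] terms are the whole polynomial minus its middle terms, with
    coefficients O(1/m), and its last terms, which [tail_bound] makes O(1/m) despite crude
    coefficients. [bern_head_coef_bound] then applies. *)
Lemma rounding_head_bound s : exists2 C : R, 0 <= C &
  forall m a eta, (3 * s + 2 <= m)%N ->
    (forall j, (j <= s + m)%N -> `|a j| * 'C(s + m, j)%:R <= 1) ->
    (forall x, 0 <= x <= (2 * m%:R)^-1 ->
      `|(bern m (fun k => ((s + m) ^_ s)%:R * iter s fdiff a k)).[x]| <= eta) ->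
    forall k, (k <= s)%N ->
      `|((s + m) ^_ s)%:R * iter s fdiff a k| <= C * (eta + m%:R^-1).
Proof.
have [C C0 hC] := bern_head_coef_bound (R := R) s.
pose K : R := (2 ^ s * 2 ^ s.+1 * s.+1`!)%:R + (4 ^ s)%:R * 2.
have K0 : 0 <= K by rewrite addr_ge0 ?mulr_ge0.
exists (C * (1 + K)); first by rewrite mulr_ge0// addr_ge0.
move=> m a eta sm ha hD k ks; set D := fun k => _ in hD *.
have m0 : (0 < m)%N by lia.
have mR0 : 0 < m%:R :> R by rewrite ltr0n.
have eta0 : 0 <= eta.
  by rewrite (le_trans _ (hD 0 _))// lexx invr_ge0 mulr_ge0 ?ltW.
have crude j : (j <= m)%N -> `|D j| <= ((4 * m) ^ s)%:R.
  move=> jm; rewrite -[X in _ <= X]mulr1.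
  apply: le_trans (norm_ffact_iter_fdiff_le (k := j) (M := 1) m _) _.
    move=> i /andP[_ ij]; have ism : (i <= s + m)%N by lia.
    by apply: le_trans (ha i ism); rewrite ler_peMr// ler1n bin_gt0.
  by rewrite ler_wpM2r// ler_nat -expnMn leq_expnl//; lia.
apply: le_trans (hC m D (eta + K * m%:R^-1) m0 _ _ k ks) _; first by lia.
  move=> x xm.
  have x01 : 0 <= x <= 1.
    case/andP: xm => -> /le_trans; apply.
    by rewrite invf_le1 ?mulr_gt0// -natrM ler1n; lia.
  (* [b] majorizes the coefficients left once the head is removed: the middle bound everywhere, plus
     the crude bound on the last [s + 1] indices. *)
  pose b k := (2 ^ s * 2 ^ s.+1 * s.+1`!)%:R / m%:R + ((4 * m) ^ s)%:R * (m - s <= k)%N%:R :> R.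
  have -> : \sum_(k < s.+1) D k * (bernp m k).[x] =
      (bern m (fun k => D k - (if (k <= s)%N then 0 else D k))).[x].
    rewrite horner_bern -(subnKC (_ : s.+1 <= m.+1)%N); last by lia.
    rewrite big_split_ord /= [X in _ = _ + X]big1 ?addr0.
      by apply: eq_bigr => i _; rewrite leq_ord subr0.
    by move=> i _; rewrite ifF ?subrr ?mul0r//; lia.
  rewrite bernB hornerD hornerN.
  apply: le_trans (ler_normB _ _) (lerD (hD x xm) _).
  apply: le_trans (ler_norm_bern (b := b) x01 _) _.
    move=> j jm; rewrite /b; case: leqP => [js|sj].
      by rewrite normr0 addr_ge0 ?mulr_ge0// invr_ge0 ltW.
    case: leqP => [_|jms].
      by rewrite mulr1 (le_trans (crude j jm))// lerDr mulr_ge0// invr_ge0 ltW.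
    by rewrite mulr0 addr0; apply: mid_coef_bound => //; lia.
  rewrite bernD hornerD bern_cst hornerC bernZ hornerZ mulrDl lerD2l.
  apply: le_trans (ler_wpM2l _ (tail_bound sm xm)) _ => //.
  rewrite expnMn natrM !(natrX _ m) exprS.
  have ms0 : m%:R ^+ s != 0 :> R by rewrite expf_neq0// gt_eqF.
  move: (m%:R ^+ s) ms0 => u u0.
  suff -> : (4 ^ s)%:R * u * (2 / (m%:R * u)) = (4 ^ s)%:R * 2 / m%:R :> R by [].
  by move: (4 ^ s)%:R => v; field; rewrite u0 gt_eqF.
rewrite -mulrA ler_wpM2l// -subr_ge0.
have -> : (1 + K) * (eta + m%:R^-1) - (eta + K / m%:R) = K * eta + m%:R^-1 by ring.
by rewrite addr_ge0 ?mulr_ge0// invr_ge0 ltW.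
Qed.

Lemma iter_fdiff_rev s n a k : (k + s <= n)%N ->
  iter s fdiff (fun j => a (n - j)%N) k = (-1) ^+ s * iter s fdiff a (n - s - k)%N.
Proof.
elim: s k => [|s IH] k kn; first by rewrite mul1r subn0.
rewrite !iterS /fdiff !IH; try lia.
have -> : (n - s.+1 - k).+1 = (n - s - k)%N by lia.
have -> : (n - s - k.+1)%N = (n - s.+1 - k)%N by lia.
by rewrite exprS; ring.
Qed.

(** Small [k] belong to the head, intermediate [k] to [mid_coef_bound], and large [k] reduce to the
    head under [x -> 1 - x], which preserves the region [m x (1 - x) <= 1]. That region contains the
    points within [1 / (2 m)] of either end. *)
Lemma rounding_coef_bound s : exists2 C : R, 0 <= C &
  forall m a eta, (3 * s + 2 <= m)%N ->
    (forall j, (j <= s + m)%N -> `|a j| * 'C(s + m, j)%:R <= 1) ->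
    (forall x, 0 <= x <= 1 -> m%:R * (x * (1 - x)) <= 1 ->
      `|((bern (s + m) a)^`(s)).[x]| <= eta) ->
    forall k, (k <= m)%N ->
      `|((s + m) ^_ s)%:R * iter s fdiff a k| <= C * (eta + m%:R^-1).
Proof.
have [C C0 hC] := rounding_head_bound s.
exists (C + (2 ^ s * 2 ^ s.+1 * s.+1`!)%:R); first by rewrite addr_ge0.
move=> m a eta sm ha hD k km.
have mR0 : 0 < m%:R :> R by rewrite ltr0n; lia.
have {}hD x : 0 <= x <= 1 -> m%:R * (x * (1 - x)) <= 1 ->
    `|(bern m (fun k => ((s + m) ^_ s)%:R * iter s fdiff a k)).[x]| <= eta.
  by move=> x01 xm; rewrite bernZ -derivn_bern hD.
have near0 x : 0 <= x <= (2 * m%:R)^-1 -> 0 <= x <= 1 /\ m%:R * (x * (1 - x)) <= 1.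
  move=> /andP[x0 xm]; have x1 : x <= 1.
    by rewrite (le_trans xm)// invf_le1 ?mulr_gt0// -natrM ler1n; lia.
  split; first by rewrite x0.
  have : x * (2 * m%:R) <= 1 by rewrite -ler_pdivlMr ?mulr_gt0// mul1r.
  have : 0 <= m%:R * x by rewrite mulr_ge0.
  have : 0 <= m%:R * x * x by rewrite !mulr_ge0.
  by lra.
have eta0 : 0 <= eta.
  by apply: le_trans (normr_ge0 _) (hD 0 _ _); rewrite ?mul0r ?mulr0 ?lexx ler01.
have i0 : 0 <= m%:R^-1 :> R by rewrite invr_ge0 ltW.
rewrite mulrDl.
have [ks|sk] := leqP k s.
  rewrite (le_trans (hC m a eta sm ha _ k ks))//.
    by move=> x /near0[]; exact: hD.
  by rewrite lerDl mulr_ge0// addr_ge0.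
have [ms|km'] := leqP (m - s) k; last first.
  apply: le_trans (mid_coef_bound _ ha sk _) _; try lia.
  apply: ler_wpDl; first by rewrite mulr_ge0// addr_ge0.
  by rewrite ler_wpM2l// lerDr.
pose a' j := a (s + m - j)%N.
have ha' j : (j <= s + m)%N -> `|a' j| * 'C(s + m, j)%:R <= 1.
  by move=> jm; rewrite -bin_sub// ha// leq_subr.
have e j : (j <= m)%N -> iter s fdiff a' j = (-1) ^+ s * iter s fdiff a (m - j)%N.
  by move=> jm; rewrite iter_fdiff_rev ?addKn//; lia.
have := hC m a' eta sm ha' _ (m - k)%N _.
rewrite e ?leq_subr// subKn// mulrCA normrM normrX normrN1 expr1n mul1r => h.
rewrite (le_trans (h _ _))//; last 2 first.
- lia.
- by rewrite lerDl mulr_ge0// addr_ge0.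
move=> x /near0[x01 xm].
have -> : bern m (fun k => ((s + m) ^_ s)%:R * iter s fdiff a' k) =
    (-1) ^+ s *: bern m (fun k => ((s + m) ^_ s)%:R * iter s fdiff a (m - k)%N).
  by rewrite -bernZ; apply: eq_bern => j jm; rewrite e// mulrCA.
rewrite hornerZ normrM normrX normrN1 expr1n mul1r.
rewrite -(bern_rev m (fun k => ((s + m) ^_ s)%:R * iter s fdiff a k)) hD//.
  by case/andP: x01 => *; apply/andP; split; lra.
by rewrite opprB addrCA subrr addr0 [(1 - x) * x]mulrC.
Qed.

End ErrorCoefficients.

(** * Mean values and second differences *)

Section MeanValue.
Context {R : realType}.
Implicit Types (a b h x : R) (u : nat -> R -> R).

Lemma within_continuous_shift (f : R -> R) a b h :
  {within `[a + h, b + h], continuous f} ->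
  {within `[a, b], continuous (fun t => f (t + h))}.
Proof.
move=> /subspace_continuousP cf; apply/subspace_continuousP => x.
rewrite /= in_itv /= => /andP[ax xb].
have xh : x + h \in `[a + h, b + h] by rewrite in_itv /= !lerD2r ax.
apply: cvg_comp (cf _ xh) => P /= hP.
have : \forall t \near x, t + h \in `[a + h, b + h] -> P (t + h).
  have : (fun t => t + h) @ x --> x + h by apply: cvgD; [exact: cvg_id|exact: cvg_cst].
  by move=> /(_ _ hP).
apply: filterS => t Pt /=; rewrite in_itv /= => /andP[at_ tb].
by apply: Pt; rewrite in_itv /= !lerD2r at_.
Qed.

(** Induction applied to the family [t |-> u i (t + h) - u i t], followed by one mean value theorem
    for [u s] between [xi] and [xi + h]. *)
Lemma fdiff_mvt s u a h : 0 < h ->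
  (forall i, (i < s)%N -> {in `]a, a + s%:R * h[, forall x,
     is_derive x 1 (u i) (u i.+1 x)}) ->
  (forall i, (i < s)%N -> {within `[a, a + s%:R * h], continuous (u i)}) ->
  exists2 xi, xi \in `[a, a + s%:R * h] &
    iter s fdiff (fun k => u 0%N (a + k%:R * h)) 0%N = h ^+ s * u s xi.
Proof.
move=> h0; elim: s u => [|s IH] u du cu.
  by exists a; rewrite ?in_itv /= ?mul0r ?addr0 ?lexx// expr0 mul1r.
have eS : a + s.+1%:R * h = a + s%:R * h + h by rewrite -natr1; ring.
rewrite eS in du cu *.
have sub1 : `[a, a + s%:R * h] `<=` `[a, a + s%:R * h + h].
  by move=> x /=; rewrite !in_itv /= => /andP[-> /le_trans->//]; rewrite lerDl ltW.
have sub2 : `[a + h, a + s%:R * h + h] `<=` `[a, a + s%:R * h + h].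
  by move=> x /=; rewrite !in_itv /= => /andP[+ ->]; rewrite andbT; apply: le_trans; rewrite lerDl ltW.
pose v i t := u i (t + h) - u i t.
have [||xi xiI e] := IH v.
- move=> i si x; rewrite in_itv /= => /andP[ax xs].
  have i1 : is_derive x 1 (u i) (u i.+1 x).
    by apply: du; rewrite ?ltnS ?(ltnW si)// in_itv /= ax (lt_trans xs)// ltrDl.
  have i2 : is_derive (x + h) 1 (u i) (u i.+1 (x + h)).
    by apply: du; rewrite ?ltnS ?(ltnW si)// in_itv /= ltrD2r xs andbT (lt_trans ax)// ltrDl.
  have i3 : is_derive x 1 (u i \o shift h) (u i.+1 (x + h) * 1).
    by apply: is_derive1_comp; exact: is_derive_shift.
  rewrite mulr1 in i3.
  exact: is_deriveB.
- move=> i si; apply: (@within_continuousB _ _ _ _ (fun t => u i (t + h)) (u i)).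
    apply: within_continuous_shift; apply: continuous_subspaceW sub2 _.
    exact: cu (ltnW _).
  by apply: continuous_subspaceW sub1 _; exact: cu (ltnW _).
have xiI' : xi \in `[a, a + s%:R * h + h] by exact: sub1.
move: xiI; rewrite in_itv /= => /andP[axi xis].
have [|||c cI ec] := @MVT _ (u s) (u s.+1) xi (xi + h).
- by rewrite ltrDl.
- move=> x; rewrite in_itv /= => /andP[xix xxi]; apply: du => //.
  by rewrite in_itv /= (le_lt_trans axi)// (lt_le_trans xxi)// lerD2r.
- apply: continuous_subspaceW (cu s (ltnSn s)) => x /=.
  by rewrite !in_itv /= => /andP[/(le_trans axi)-> /le_trans->//]; rewrite lerD2r.
exists c.
  move: cI; rewrite !in_itv /= => /andP[xic cxi]; apply/andP; split.
    by rewrite (le_trans axi)// ltW.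
  by rewrite (le_trans (ltW cxi))// lerD2r.
rewrite -iterS iterSr.
have -> : iter s fdiff (fdiff (fun k => u 0%N (a + k%:R * h))) =
    iter s fdiff (fun k => v 0%N (a + k%:R * h)).
  by congr (iter s fdiff _); apply/funext => k; rewrite /fdiff /v -natr1 mulrDl mul1r addrA.
rewrite e /v ec addrC addKr exprS; ring.
Qed.

End MeanValue.

Section PolynomialEstimates.
Context {R : realType}.
Implicit Types (p g G : {poly R}) (x y h d Psi : R) (m k s : nat).

Lemma poly_MVT p x y : x < y ->
  exists2 c, c \in `]x, y[ & p.[y] - p.[x] = p^`().[c] * (y - x).
Proof.
move=> xy; apply: (@MVT _ (horner p) (horner p^`())) => //.
by apply: continuous_subspaceT; exact: continuous_horner.
Qed.

Lemma poly_lipschitz p (A : R) : (forall x, 0 <= x <= 1 -> `|p^`().[x]| <= A) ->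
  forall x y, 0 <= x <= 1 -> 0 <= y <= 1 -> `|p.[x] - p.[y]| <= A * `|x - y|.
Proof.
move=> pA; suff lt x y : 0 <= x -> x < y -> y <= 1 -> `|p.[y] - p.[x]| <= A * `|y - x|.
  move=> x y /andP[x0 x1] /andP[y0 y1]; have [xy|yx|->] := ltgtP x y.
  - by rewrite distrC [X in _ * X]distrC lt.
  - exact: lt.
  - by rewrite !subrr normr0 mulr0.
move=> x0 xy y1; have [c] := poly_MVT p xy; rewrite in_itv /= => /andP[xc cy] ->.
by rewrite normrM ler_wpM2r// pA// (le_trans x0 (ltW xc)) (le_trans (ltW cy)).
Qed.

Lemma derivn_comp_shift p h i :
  (p \Po ('X + h%:P))^`(i) = p^`(i) \Po ('X + h%:P).
Proof.
by elim: i => [//|i IH]; rewrite !derivnS IH deriv_comp derivD derivX derivC addr0 mulr1.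
Qed.

(* With [u w = G (x + w) + G (x - w) - 2 G x], the second difference [u d] is
   the integral of [(d - w) u'' w] over [0, d]; the mean value theorem for
   [w |-> (d - w) u' w + u w] yields the estimate without integration. *)
Lemma symdiff2_poly_le G Psi x d :
  (forall y, 0 <= y <= 1 -> y * (1 - y) * `|G^`(2).[y]| <= Psi) ->
  0 < d -> d <= x -> x + d <= 1 ->
  `|G.[x + d] - 2 * G.[x] + G.[x - d]| <= 2 * Psi * d ^+ 2 * (x^-1 + (1 - x)^-1).
Proof.
move=> hG d0 dx xd1.
have x0 : 0 < x by exact: lt_le_trans dx.
have x1 : x < 1 by rewrite (lt_le_trans _ xd1)// ltrDl.
have Psi0 : 0 <= Psi.
  by apply: le_trans (hG x _); rewrite ?mulr_ge0 ?subr_ge0 ?(ltW x0) ?(ltW x1).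
have hG' y : 0 < y -> y < 1 -> `|G^`(2).[y]| <= Psi * (y^-1 + (1 - y)^-1).
  move=> y0 y1; have y1' : 0 < 1 - y by rewrite subr_gt0.
  have -> : y^-1 + (1 - y)^-1 = (y * (1 - y))^-1 by field; rewrite !gt_eqF.
  by rewrite ler_pdivlMr ?mulr_gt0// mulrC hG// (ltW y0) (ltW y1).
pose u : {poly R} := (G \Po (x%:P + 'X)) + (G \Po (x%:P - 'X)) - (2 * G.[x])%:P.
have u1 : u^`() = (G^`() \Po (x%:P + 'X)) - (G^`() \Po (x%:P - 'X)).
  rewrite /u derivB derivD !deriv_comp derivD derivB derivX !derivC.
  by rewrite subr0 add0r mulr1 sub0r mulrN1.
have u2 : u^`()^`() = (G^`(2) \Po (x%:P + 'X)) + (G^`(2) \Po (x%:P - 'X)).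
  rewrite u1 derivB !deriv_comp derivD derivB derivX !derivC.
  by rewrite add0r mulr1 sub0r mulrN1 opprK.
pose W : {poly R} := (d%:P - 'X) * u^`() + u.
have W1 : W^`() = (d%:P - 'X) * u^`()^`().
  by rewrite /W derivD derivM derivB derivX derivC sub0r mulN1r addrAC addNr add0r.
have [c] := poly_MVT W d0; rewrite in_itv /= => /andP[c0 cd] eW.
have -> : G.[x + d] - 2 * G.[x] + G.[x - d] = W.[d] - W.[0].
  rewrite /W u1 /u !(hornerD, hornerN, hornerM, horner_comp, hornerC, hornerX).
  by rewrite !subr0 !addr0; ring.
rewrite eW subr0 W1 u2 !(hornerD, hornerN, hornerM, horner_comp, hornerC, hornerX).
have xc0 : 0 < x - c by lra.
have xc1 : x + c < 1 by lra.
rewrite normrM normrM (gtr0_norm d0) (@gtr0_norm _ (d - c)) ?subr_gt0//.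
have h1 := hG' (x + c) (addr_gt0 x0 c0) xc1.
have xc2 : x - c < 1 by lra.
have h2 := hG' (x - c) xc0 xc2.
(* The factor [d - c] compensates the growth of the inverse weight at [x + c] and [x - c]; [f1] to
   [f4] move each partial fraction back to [x]. *)
have frac a b : 0 < a -> 0 < b -> (d - c) * a <= d * b -> (d - c) * b^-1 <= d * a^-1.
  move=> a0 b0 h; rewrite ler_pdivrMr// mulrAC ler_pdivlMr//.
have dc0 : 0 <= d * c by rewrite mulr_ge0 ?ltW.
have cx0 : 0 <= c * (x - d) by rewrite mulr_ge0 ?subr_ge0// ltW.
have cx1 : 0 <= c * (1 - x - d) by apply: mulr_ge0; lra.
have f1 : (d - c) * (x + c)^-1 <= d * x^-1 by apply: frac; lra.
have f2 : (d - c) * (x - c)^-1 <= d * x^-1 by apply: frac; lra.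
have f3 : (d - c) * (1 - (x + c))^-1 <= d * (1 - x)^-1 by apply: frac; lra.
have f4 : (d - c) * (1 - (x - c))^-1 <= d * (1 - x)^-1 by apply: frac; lra.
apply: (@le_trans _ _ ((d - c) * (Psi * ((x + c)^-1 + (1 - (x + c))^-1) +
    Psi * ((x - c)^-1 + (1 - (x - c))^-1)) * d)).
  rewrite ler_wpM2r ?(ltW d0)// ler_wpM2l ?subr_ge0 ?(ltW cd)//.
  by rewrite (le_trans (ler_normD _ _))// lerD.
have -> : (d - c) * (Psi * ((x + c)^-1 + (1 - (x + c))^-1) +
    Psi * ((x - c)^-1 + (1 - (x - c))^-1)) * d =
  Psi * d * ((d - c) * (x + c)^-1 + (d - c) * (1 - (x + c))^-1 +
    ((d - c) * (x - c)^-1 + (d - c) * (1 - (x - c))^-1)) by ring.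
have -> : 2 * Psi * d ^+ 2 * (x^-1 + (1 - x)^-1) =
  Psi * d * (d * x^-1 + d * (1 - x)^-1 + (d * x^-1 + d * (1 - x)^-1)) by ring.
by rewrite ler_wpM2l ?mulr_ge0 ?(ltW d0)// !lerD.
Qed.

End PolynomialEstimates.

(** * Derivatives of Bernstein images *)

Definition bernf {R : fieldType} (n : nat) (f : R -> R) : {poly R} :=
  bern n (fun k => f (k%:R / n%:R)).

(* [u i] plays the role of the derivative of order [i]; families rather than
   iterated operators let differences [f - p] be treated like [f]. *)
Definition deriv_tower01 {R : realType} (s : nat) (u : nat -> R -> R) : Prop :=
  forall i, (i < s)%N ->
    {in `]0, 1[, forall x : R, is_derive x 1 (u i) (u i.+1 x)} /\
    {within `[0, 1], continuous (u i)}.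

Section BernsteinOperator.
Context {R : realType}.
Implicit Types (p g : {poly R}) (x y h M : R) (m k s : nat) (u : nat -> R -> R).

Lemma deriv_tower01_poly s p : deriv_tower01 s (fun i => horner p^`(i)).
Proof.
move=> i _; split; first by move=> x _; rewrite derivnS; exact: is_derive_poly.
by apply: continuous_subspaceT; exact: continuous_horner.
Qed.

Lemma deriv_tower01B s u v : deriv_tower01 s u -> deriv_tower01 s v ->
  deriv_tower01 s (fun i x => u i x - v i x).
Proof.
move=> tu tv i si; have [du cu] := tu i si; have [dv cv] := tv i si; split.
  by move=> x xI; have h1 := du x xI; have h2 := dv x xI; exact: is_deriveB.
exact: within_continuousB.
Qed.

Lemma iter_fdiff_shift s (c : nat -> R) k :
  iter s fdiff c k = iter s fdiff (fun j => c (k + j)%N) 0%N.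
Proof.
suff h j : iter s fdiff (fun j => c (k + j)%N) j = iter s fdiff c (k + j)%N.
  by rewrite h addn0.
by elim: s j => [//|s IH] j; rewrite !iterS /fdiff !IH addnS.
Qed.

(** The location of [xi] is recorded because later estimates depend on its distance to a given point
    or to the ends of the interval. *)
Lemma node_fdiff_mvt s m k u : (0 < s + m)%N -> (k <= m)%N -> deriv_tower01 s u ->
  exists2 xi, k%:R <= (s + m)%:R * xi <= (k + s)%:R &
    iter s fdiff (fun j => u 0%N (j%:R / (s + m)%:R)) k =
    (s + m)%:R^-1 ^+ s * u s xi.
Proof.
move=> n0 km tu; set n := (s + m)%N in n0 *.
have nR0 : 0 < n%:R :> R by rewrite ltr0n.
have h0 : 0 < n%:R^-1 :> R by rewrite invr_gt0.
have k0 : 0 <= k%:R / n%:R :> R by rewrite divr_ge0.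
have ks1 : k%:R / n%:R + s%:R * n%:R^-1 <= 1 :> R.
  by rewrite -mulrDl ler_pdivrMr// mul1r -natrD ler_nat /n; lia.
have [||xi] := @fdiff_mvt _ s u (k%:R / n%:R) n%:R^-1 h0.
- move=> i si x; rewrite in_itv /= => /andP[kx xk]; apply: (tu i si).1.
  by rewrite in_itv /= (le_lt_trans k0 kx) (lt_le_trans xk ks1).
- move=> i si; apply: continuous_subspaceW (tu i si).2 => x /=.
  by rewrite !in_itv /= => /andP[/(le_trans k0)-> /le_trans->].
rewrite in_itv /= => /andP[kxi xik] e; exists xi.
  rewrite mulrC -ler_pdivrMr// kxi /= -ler_pdivlMr//.
  by rewrite natrD mulrDl.
rewrite iter_fdiff_shift -e; congr (iter s fdiff _ _).
by apply/funext => j; rewrite natrD mulrDl.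
Qed.

(** The ratio is at least [(1 - s / n) ^ s], to which Bernoulli's inequality applies. *)
Lemma ffact_ratio_bounds n s : (0 < n)%N -> (s <= n)%N ->
  1 - (s ^ 2)%:R / n%:R <= (n ^_ s)%:R * (n%:R^-1 : R) ^+ s <= 1.
Proof.
move=> n0 sn; have nR0 : 0 < n%:R :> R by rewrite ltr0n.
apply/andP; split; last first.
  by rewrite exprVn ler_pdivrMr ?exprn_gt0// mul1r -natrX ler_nat leq_ffact_expn.
apply: (@le_trans _ _ ((n - s)%:R ^+ s * n%:R^-1 ^+ s)); last first.
  by rewrite ler_wpM2r ?exprn_ge0 ?invr_ge0 ?(ltW nR0)// -natrX ler_nat leq_expn_ffact.
have -> : 1 - (s ^ 2)%:R / n%:R = 1 - s%:R * (s%:R / n%:R) :> R.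
  by rewrite natrX expr2 mulrA.
rewrite -exprMn natrB// mulrBl mulfV ?gt_eqF//.
apply: bernoulli_ineq; rewrite divr_ge0//= ler_pdivrMr// mul1r ler_nat//.
Qed.

Section CoefficientBounds.
Context (s m : nat) (u : nat -> R -> R) (M : R).
Context (n0 : (0 < s + m)%N) (tu : deriv_tower01 s u).
Context (uM : forall x, 0 <= x <= 1 -> `|u s x| <= M).

Let D k := ((s + m) ^_ s)%:R * iter s fdiff (fun j => u 0%N (j%:R / (s + m)%:R)) k.

(** Each coefficient is a value of [u s] times [n ^_ s / n ^ s <= 1], where [n = s + m]. *)
Lemma bernf_coef_le k : (k <= m)%N -> `|D k| <= M.
Proof.
move=> km; have [xi /andP[kxi xik] e] := node_fdiff_mvt n0 km tu.
have nR0 : 0 < (s + m)%:R :> R by rewrite ltr0n.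
have xi01 : 0 <= xi <= 1.
  rewrite -(pmulr_rge0 _ nR0) (le_trans _ kxi)//=.
  by rewrite -(ler_pM2l nR0) mulr1 (le_trans xik)// ler_nat addnC leq_add2l.
rewrite /D e mulrA normrM -[M]mul1r ler_pM// ?uM//.
have /andP[_ h] := ffact_ratio_bounds n0 (leq_addr m s).
by rewrite ger0_norm// mulr_ge0// exprn_ge0// invr_ge0 ltW.
Qed.

Lemma derivn_bernf : (bernf (s + m) (u 0%N))^`(s) = bern m D.
Proof. by rewrite derivn_bern -bernZ. Qed.

Lemma norm_derivn_bernf_le x : 0 <= x <= 1 ->
  `|(bernf (s + m) (u 0%N))^`(s).[x]| <= M.
Proof. by move=> x01; rewrite derivn_bernf; apply: norm_bern_le => //; exact: bernf_coef_le. Qed.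

Lemma norm_derivnS_bernf_le x : 0 <= x <= 1 ->
  `|(bernf (s + m) (u 0%N))^`(s.+1).[x]| <= 2 * m%:R * M.
Proof.
by move=> x01; rewrite derivnS derivn_bernf; apply: norm_deriv_bern_le => //; exact: bernf_coef_le.
Qed.

Lemma phi_derivnSS_bernf_le x : 0 <= x <= 1 ->
  x * (1 - x) * `|(bernf (s + m) (u 0%N))^`(s.+2).[x]| <= 4 * m%:R * M.
Proof.
move=> x01; have -> : (bernf (s + m) (u 0%N))^`(s.+2) = (bern m D)^`(2).
  by rewrite !derivnS derivn_bernf.
by apply: phi_deriv2_bern_le => //; exact: bernf_coef_le.
Qed.

End CoefficientBounds.

End BernsteinOperator.

(** * Bernstein images of polynomials: local comparison and weighted stability *)

Section PolynomialImages.
Context {R : realType}.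
Implicit Types (g : {poly R}) (x y M : R) (m k s : nat).

(** The coefficient of index [k] is [rho] times the derivative at [xi], with [1 - rho <= s ^ 2 / m]
    and [xi] within [(|k - m x| + 2 s) / m] of [x]. In the region considered the first absolute
    moment is at most 1. *)
Lemma derivn_bernf_poly_near s m g (A B : R) x : (0 < m)%N ->
  (forall y, 0 <= y <= 1 -> `|g^`(s).[y]| <= A) ->
  (forall y, 0 <= y <= 1 -> `|g^`(s.+1).[y]| <= B) ->
  0 <= x <= 1 -> m%:R * (x * (1 - x)) <= 1 ->
  `|(bernf (s + m) (horner g))^`(s).[x] - g^`(s).[x]| <=
    ((s ^ 2)%:R * A + (2 * s + 1)%:R * B) / m%:R.
Proof.
move=> m0 gA gB x01 xm; have tg := deriv_tower01_poly (s := s) g.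
have n0 : (0 < s + m)%N by lia.
have mR0 : 0 < m%:R :> R by rewrite ltr0n.
have nR0 : 0 < (s + m)%:R :> R by rewrite ltr0n.
have A0 : 0 <= A by rewrite (le_trans _ (gA x x01)).
have B0 : 0 <= B by rewrite (le_trans _ (gB x x01)).
have mn : (s + m)%:R^-1 <= m%:R^-1 :> R by rewrite lef_pV2 ?posrE// ler_nat leq_addl.
have -> : (bernf (s + m) (horner g))^`(s) = bern m (fun k => ((s + m) ^_ s)%:R *
    iter s fdiff (fun j => g.[j%:R / (s + m)%:R]) k).
  exact: (derivn_bernf s m (fun i => horner g^`(i))).
rewrite -[g^`(s).[x]](hornerC _ x) -(bern_cst m) -hornerN -hornerD -bernB.
pose b k := ((s ^ 2)%:R * A + (2 * s)%:R * B) / m%:R + B / m%:R * `|k%:R - m%:R * x|.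
apply: le_trans (ler_norm_bern (b := b) x01 _) _; last first.
  rewrite /b bernD hornerD bern_cst hornerC bernZ hornerZ natrD !mulrDl -addrA lerD2l.
  rewrite lerD2l mul1r ler_piMr ?divr_ge0//.
  by apply: le_trans (horner_abs_moment_le m x01) _; rewrite ler_pdivrMr// mul1r; lra.
move=> k km; have [xi /andP[kxi xik] e] := node_fdiff_mvt n0 km tg.
have xi01 : 0 <= xi <= 1.
  rewrite -(pmulr_rge0 _ nR0) (le_trans _ kxi)//=.
  by rewrite -(ler_pM2l nR0) mulr1 (le_trans xik)// ler_nat addnC leq_add2l.
rewrite e mulrA; have /andP[r1 r2] := ffact_ratio_bounds (R := R) n0 (leq_addr m s).
set rho := ((s + m) ^_ s)%:R * _ in r1 r2 *.
have -> : rho * g^`(s).[xi] - g^`(s).[x] =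
  - ((1 - rho) * g^`(s).[xi]) + (g^`(s).[xi] - g^`(s).[x]) by ring.
have h1 : `|(1 - rho) * g^`(s).[xi]| <= (s ^ 2)%:R / m%:R * A.
  rewrite normrM ler_pM ?gA// ger0_norm ?subr_ge0// lerBlDl.
  by rewrite -lerBlDr (le_trans _ r1)// lerD2l lerN2 ler_wpM2l.
have h2 : `|g^`(s).[xi] - g^`(s).[x]| <= B * ((`|k%:R - m%:R * x| + (2 * s)%:R) / m%:R).
  apply: le_trans (poly_lipschitz _ xi01 x01) _; first by move=> y; rewrite -derivnS; exact: gB.
  rewrite ler_wpM2l//; apply: (@le_trans _ _ ((`|k%:R - m%:R * x| + (2 * s)%:R) / (s + m)%:R)).
    rewrite ler_pdivlMr// -[X in _ * X]ger0_norm ?ler0n// -normrM.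
    have -> : (xi - x) * (s + m)%:R =
      ((s + m)%:R * xi - k%:R) + (k%:R - m%:R * x) - s%:R * x by rewrite natrD; ring.
    have sx : (0 : R) <= s%:R * x <= s%:R.
      by case/andP: x01 => x0 x1; rewrite mulr_ge0//= ler_piMr.
    have kx : 0 <= (s + m)%:R * xi - k%:R <= s%:R.
      by rewrite subr_ge0 kxi lerBlDl -natrD.
    move: sx kx => /andP[sx0 sx1] /andP[kx0 kx1].
    apply: le_trans (ler_normB _ _) _; rewrite (ger0_norm sx0).
    apply: (@le_trans _ _ (`|(s + m)%:R * xi - k%:R| + `|k%:R - m%:R * x| + s%:R)).
      by rewrite lerD// ler_normD.
    by rewrite (ger0_norm kx0) natrM; lra.
  by rewrite ler_wpM2l// addr_ge0.
apply: le_trans (ler_normD _ _) _; rewrite normrN.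
apply: le_trans (lerD h1 h2) _; rewrite /b le_eqVlt; apply/orP; left; apply/eqP; ring.
Qed.

(** Multiplication by [x / (k + 1)] turns the basis polynomial of index [k] and degree [m] into that
    of index [k + 1] and degree [m + 1], divided by [m + 1]; these sum to at most [1 / (m + 1)]. *)
Lemma bern_inv_le m x : 0 <= x <= 1 ->
  x * (bern m (fun k => k.+1%:R^-1)).[x] <= m.+1%:R^-1.
Proof.
move=> x01; rewrite horner_bern mulr_sumr.
have e (k : 'I_m.+1) : x * (k.+1%:R^-1 * (bernp m k).[x]) = m.+1%:R^-1 * (bernp m.+1 k.+1).[x].
  rewrite !horner_bernp subSS exprS.
  have := congr1 (fun n => n%:R : R) (mul_bin_diag m.+1 k); rewrite /= !natrM => h.
  have -> : 'C(m, k)%:R = k.+1%:R * 'C(m.+1, k.+1)%:R / m.+1%:R :> R.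
    by rewrite -h mulrC mulKf ?pnatr_eq0.
  by field; rewrite ![1 + _]addrC !natr1 !pnatr_eq0.
rewrite (eq_bigr _ (fun (k : 'I_m.+1) _ => e k)) -mulr_sumr ler_piMr ?invr_ge0//.
have := congr1 (fun p => p.[x]) (sum_bernp (R := R) m.+1).
rewrite /= horner_sum hornerC big_ord_recl => <-.
by rewrite lerDr bernp_ge0.
Qed.

(** A mean value for all [s + 2] differences could land on an end point, where the weight vanishes.
    Two differences are therefore kept, as the polynomial [q], and estimated by [symdiff2_poly_le];
    [bern_inv_le] sums the resulting inverses of [k + 1] and [m - k + 1]. *)
Lemma phi_derivn_bernf_poly_le s m g Psi x :
  (forall y, 0 <= y <= 1 -> y * (1 - y) * `|g^`(s.+2).[y]| <= Psi) ->
  0 <= x <= 1 ->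
  x * (1 - x) * `|(bernf (s.+2 + m) (horner g))^`(s.+2).[x]| <= 4 * s.+2%:R * Psi.
Proof.
move=> hg x01; have [n nE] : exists n, (s.+2 + m)%N = n by eexists.
rewrite nE; have n0 : (0 < n)%N by rewrite -nE.
have nR0 : 0 < n%:R :> R by rewrite ltr0n.
have Psi0 : 0 <= Psi by apply: le_trans (hg 0 _); rewrite ?mul0r ?lexx ?ler01.
pose q : {poly R} := (g \Po ('X + (2 / n%:R)%:P)) - 2%:P * (g \Po ('X + (n%:R^-1)%:P)) + g.
have qs : q^`(s) = (g^`(s) \Po ('X + (2 / n%:R)%:P)) -
    2%:P * (g^`(s) \Po ('X + (n%:R^-1)%:P)) + g^`(s).
  by rewrite /q derivnD derivnB !mul_polyC derivnZ !derivn_comp_shift.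
pose b k : R := 2 * Psi * n%:R * (k.+1%:R^-1 + (m - k).+1%:R^-1).
have hb k : (k <= m)%N -> `|(n ^_ s.+2)%:R * iter s.+2 fdiff (fun j => g.[j%:R / n%:R]) k| <= b k.
  move=> km.
  have -> : iter s.+2 fdiff (fun j => g.[j%:R / n%:R]) k =
      iter s fdiff (fun j => q.[j%:R / n%:R]) k.
    rewrite !iterSr; congr (iter s fdiff _ k); apply/funext => j.
    rewrite /fdiff /q !(hornerD, hornerN, hornerM, horner_comp, hornerC, hornerX).
    have -> : j%:R / n%:R + 2 / n%:R = j.+2%:R / n%:R :> R by rewrite -mulrDl -natrD addn2.
    have -> : j%:R / n%:R + n%:R^-1 = j.+1%:R / n%:R :> R by rewrite -[j.+1%:R]natr1 mulrDl mul1r.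
    by ring.
  have nE' : n = (s + (2 + m))%N by lia.
  have tq := deriv_tower01_poly (s := s) q.
  have km2 : (k <= 2 + m)%N by lia.
  have n0' : (0 < s + (2 + m))%N by lia.
  have [xi] := node_fdiff_mvt n0' km2 tq.
  rewrite -nE' derivn0 => /andP[kxi xik] ->.
  (* [z] is the centre of the second difference. The shift by [1 / n] gives [n z >= k + 1] and
     [n (1 - z) >= m - k + 1], so both inverses are finite even for [k = 0] and [k = m]. *)
  pose z := xi + n%:R^-1.
  have kz : k.+1%:R <= n%:R * z.
    by rewrite /z mulrDr mulfV ?gt_eqF// -[k.+1%:R]natr1 lerD2r.
  have zk : (m - k).+1%:R <= n%:R * (1 - z).
    have h : ((m - k).+1 + (k + s) + 1)%:R <= n%:R :> R by rewrite ler_nat; lia.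
    have -> : n%:R * (1 - z) = n%:R - n%:R * xi - 1 by rewrite /z; field; rewrite gt_eqF.
    by move: h xik; rewrite natrD (natrD _ _.+1) => h xik; lra.
  have z0 : 0 < z by rewrite -(pmulr_rgt0 _ nR0) (lt_le_trans _ kz).
  have z1 : 0 < 1 - z by rewrite -(pmulr_rgt0 _ nR0) (lt_le_trans _ zk).
  have -> : q^`(s).[xi] = g^`(s).[z + n%:R^-1] - 2 * g^`(s).[z] + g^`(s).[z - n%:R^-1].
    rewrite qs !(hornerD, hornerN, hornerM, horner_comp, hornerC, hornerX).
    have -> : xi + 2 / n%:R = z + n%:R^-1 by rewrite /z; ring.
    by rewrite /z addrK.
  have hq : `|g^`(s).[z + n%:R^-1] - 2 * g^`(s).[z] + g^`(s).[z - n%:R^-1]| <=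
      2 * Psi * n%:R^-1 ^+ 2 * (z^-1 + (1 - z)^-1).
    apply: symdiff2_poly_le.
    - by move=> y y01; exact: hg.
    - by rewrite invr_gt0.
    - by rewrite /z lerDr -(pmulr_rge0 _ nR0) (le_trans _ kxi).
    - rewrite -lerBrDl -(ler_pM2l nR0) mulfV ?gt_eqF// (le_trans _ zk)// ler1n//.
  rewrite mulrA normrM.
  have rat : `|(n ^_ s.+2)%:R * n%:R^-1 ^+ s| <= n%:R ^+ 2 :> R.
    rewrite ger0_norm ?mulr_ge0 ?exprn_ge0 ?invr_ge0 ?(ltW nR0)//.
    rewrite exprVn ler_pdivrMr ?exprn_gt0// -exprD -natrX ler_nat add2n leq_ffact_expn//.
  apply: le_trans (ler_pM _ _ rat hq) _ => //.
  have -> : n%:R ^+ 2 * (2 * Psi * n%:R^-1 ^+ 2 * (z^-1 + (1 - z)^-1)) =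
      2 * Psi * n%:R * ((n%:R * z)^-1 + (n%:R * (1 - z))^-1).
    by field; rewrite !gt_eqF.
  rewrite /b ler_wpM2l ?mulr_ge0 ?(ltW nR0)// lerD// lef_pV2 ?posrE ?mulr_gt0 ?ltr0n//.
have -> : (bernf n (horner g))^`(s.+2) =
    bern m (fun k => (n ^_ s.+2)%:R * iter s.+2 fdiff (fun j => g.[j%:R / n%:R]) k).
  by rewrite /bernf -nE derivn_bern -bernZ.
have p0 : 0 <= x * (1 - x) by case/andP: x01 => *; rewrite mulr_ge0 ?subr_ge0.
apply: le_trans (ler_wpM2l p0 (ler_norm_bern (b := b) x01 hb)) _.
rewrite /b bernZ hornerZ bernD hornerD.
have x01' : 0 <= 1 - x <= 1 by case/andP: x01 => *; apply/andP; split; lra.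
have e1 := bern_inv_le m x01; have := bern_inv_le m x01'.
rewrite bern_rev; set S1 := horner _ _ in e1 *; set S2 := horner _ _ => e2.
have S10 : 0 <= S1.
  rewrite /S1 horner_bern; apply: sumr_ge0 => k _.
  by rewrite mulr_ge0 ?invr_ge0// bernp_ge0.
have S20 : 0 <= S2.
  rewrite /S2 horner_bern; apply: sumr_ge0 => k _.
  by rewrite mulr_ge0 ?invr_ge0// bernp_ge0.
case/andP: x01 => x0 x1.
have t1 : x * (1 - x) * S1 <= m.+1%:R^-1.
  apply: le_trans e1; rewrite mulrAC ler_piMr ?mulr_ge0//; lra.
have t2 : x * (1 - x) * S2 <= m.+1%:R^-1.
  by apply: le_trans e2; rewrite -mulrA ler_piMl ?mulr_ge0 ?subr_ge0.
have nm : n%:R * m.+1%:R^-1 <= s.+2%:R :> R.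
  by rewrite ler_pdivrMr ?ltr0n// -natrM ler_nat -nE mulnS leq_add2l leq_pmull.
apply: (@le_trans _ _ (2 * Psi * n%:R * (m.+1%:R^-1 + m.+1%:R^-1))).
  rewrite mulrCA ler_wpM2l ?mulr_ge0 ?(ltW nR0)// mulrDr lerD//.
have -> : 2 * Psi * n%:R * (m.+1%:R^-1 + m.+1%:R^-1) = 4 * Psi * (n%:R * m.+1%:R^-1) :> R by ring.
by rewrite [leRHS]mulrAC ler_wpM2l// mulr_ge0.
Qed.

End PolynomialImages.

(** * A recurrence forcing growth of order [n ^ (1 - alpha)] *)

Section Recurrence.
Context {R : realType}.

Lemma powR_mul_neg (x beta : R) : 0 < x -> x * x `^ (- beta) = x `^ (1 - beta).
Proof.
move=> x0; rewrite powRD; last by rewrite (gt_eqF x0) implybT.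
by rewrite powRr1// ltW.
Qed.

(* Comparing [n] with [N = n %/ A] for a fixed [A] such that
   [2 K <= A `^ (1 - alpha)] absorbs the factor [K]. *)
Lemma powR_recurrence (P : nat -> R -> Prop) (n1 : nat) (alpha K C : R) :
  0 < alpha -> alpha < 1 -> 0 <= K -> 0 <= C -> (0 < n1)%N ->
  (forall n a b, P n a -> a <= b -> P n b) ->
  (forall n, (n1 <= n)%N -> exists a, P n a) ->
  (forall n N a, (n1 <= N <= n)%N -> P N a ->
     P n (K * a + C * (n%:R * N%:R `^ (- alpha)))) ->
  exists2 M, 0 <= M & forall n, (n1 <= n)%N -> P n (M * n%:R `^ (1 - alpha)).
Proof.
move=> al0 al1 K0 C0 n10 Pmono Pex Pstep.
have be0 : 0 < 1 - alpha by rewrite subr_gt0.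
pose A := (Num.truncn ((2 * K) `^ (1 - alpha)^-1)).+2.
have AK : 2 * K <= A%:R `^ (1 - alpha).
  have K20 : 0 <= 2 * K by rewrite mulr_ge0.
  have -> : 2 * K = ((2 * K) `^ (1 - alpha)^-1) `^ (1 - alpha).
    by rewrite -powRrM mulVf ?gt_eqF// powRr1.
  apply: ge0_ler_powR; rewrite ?nnegrE ?powR_ge0 ?(ltW be0)//.
  by rewrite ltW// (lt_trans (truncnS_gt _))// ltr_nat.
(* For [n < A n1] the index [n / A] would fall below [n1]; the finitely many bounds from [Pex] are
   merged instead. *)
have [M0 M00 hM0] : exists2 M0, 0 <= M0 &
    forall n, (n1 <= n)%N -> (n < A * n1)%N -> P n M0.
  elim: (A * n1)%N => [|B [M0 M00 IH]]; first by exists 0.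
  have [n1B|Bn1] := leqP n1 B; last first.
    exists M0 => // n h1; rewrite ltnS => h2; have := leq_trans h1 h2.
    by rewrite leqNgt Bn1.
  have [a Pa] := Pex B n1B; exists (Num.max a M0); first by rewrite le_max M00 orbT.
  move=> n h1; rewrite ltnS leq_eqVlt => /predU1P[->|h2].
    by apply: Pmono Pa _; rewrite le_max lexx.
  by apply: Pmono (IH n h1 h2) _; rewrite le_max lexx orbT.
(* The second entry limits the forcing term to half of [M n ^ (1 - alpha)]; the choice of [A] limits
   the recursive term to the other half. *)
pose M := Num.max M0 (2 * (C * (2 * A%:R) `^ alpha)).
have M_0 : 0 <= M by rewrite le_max M00.
exists M => // n; elim/ltn_ind: n => n IH n1n.
have npos : (0 < n)%N by exact: leq_trans n1n.
have nR0 : 0 < n%:R :> R by rewrite ltr0n.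
have [nA|An] := ltnP n (A * n1).
  apply: Pmono (hM0 n n1n nA) _; rewrite (@le_trans _ _ M)//.
    by rewrite /M le_max lexx.
  rewrite ler_peMr// -[leLHS](powRr0 (n%:R : R)).
  by apply: ler_powR; rewrite ?ler1n// ltW.
pose N := (n %/ A)%N.
have n1N : (n1 <= N)%N by rewrite /N leq_divRL// mulnC.
have NA : (N * A <= n)%N by rewrite /N leq_divM.
have nNA : (n < N.+1 * A)%N by rewrite /N -ltn_divLR.
have Npos : (0 < N)%N by exact: leq_trans n1N.
have NR0 : 0 < N%:R :> R by rewrite ltr0n.
have Nn : (N < n)%N by apply: leq_trans NA; rewrite ltn_Pmulr.
apply: Pmono (Pstep n N _ _ (IH N Nn n1N)) _; first by rewrite n1N ltnW.
have h1 : K * N%:R `^ (1 - alpha) <= 2^-1 * n%:R `^ (1 - alpha).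
  have : A%:R `^ (1 - alpha) * N%:R `^ (1 - alpha) <= n%:R `^ (1 - alpha) :> R.
    rewrite -powRM// -natrM; apply: ge0_ler_powR; rewrite ?nnegrE ?(ltW be0)//.
    by rewrite ler_nat mulnC.
  have := ler_wpM2r (powR_ge0 N%:R (1 - alpha)) AK; lra.
have h2 : n%:R * N%:R `^ (- alpha) <= (2 * A%:R) `^ alpha * n%:R `^ (1 - alpha).
  rewrite -powR_mul_neg// mulrCA ler_wpM2l// !powRN ler_pdivlMr ?powR_gt0//.
  rewrite mulrC ler_pdivrMr ?powR_gt0// -powRM//.
  apply: ge0_ler_powR; rewrite ?nnegrE ?mulr_ge0 ?(ltW al0)// -!natrM ler_nat.
  apply: leq_trans (ltnW nNA) _; rewrite [leqRHS]mulnAC leq_mul2r mul2n -addnn.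
  by apply/orP; right; rewrite -addn1 leq_add2l.
have h3 : C * (n%:R * N%:R `^ (- alpha)) <= 2^-1 * (M * n%:R `^ (1 - alpha)).
  apply: le_trans (ler_wpM2l C0 h2) _; rewrite !mulrA ler_wpM2r ?powR_ge0//.
  have : 2 * (C * (2 * A%:R) `^ alpha) <= M by rewrite /M le_max lexx orbT.
  by lra.
have := ler_wpM2l M_0 h1.
rewrite mulrCA => h4; apply: le_trans (lerD h4 h3) _.
by rewrite [M * (2^-1 * _)]mulrCA -mulrDl -[X in X + _]mul1r; lra.
Qed.

End Recurrence.

(** * One-sided derivatives on [0, 1] *)

Section OneSidedDerivatives.
Context {R : realType}.
Implicit Types (f g : R -> R) (x : R) (p : {poly R}) (s : nat).

Lemma near_dnbhs01 x (P : set R) :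
  (\forall y \near within `[0, 1] x^', P y) <->
  exists2 e : R, 0 < e &
    forall y, 0 <= y <= 1 -> y != x -> `|x - y| < e -> P y.
Proof.
apply: (iff_trans (nbhs_normP x (fun y => y != x -> [set` `[0, 1]] y -> P y))).
split=> -[e /= e0 h]; exists e => //.
- by move=> y y01 yx xy; apply: h => //=; rewrite in_itv.
- by move=> y /= xy yx; rewrite in_itv /= => y01; exact: h.
Qed.

Lemma within_dnbhs01_proper x : 0 <= x <= 1 -> ProperFilter (within `[0, 1] x^').
Proof.
move=> /andP[x0 x1]; split; last exact: within_filter.
move=> /(near_dnbhs01 x (fun=> False))[e e0 h].
(* Since [d <= 1/2], a step of length [d] towards the farther end stays in [0, 1]. *)
pose d := Num.min e 1 / 2.
have d0 : 0 < d by rewrite divr_gt0// lt_min e0 ltr01.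
have de : d < e.
  by rewrite ltr_pdivrMr// (@le_lt_trans _ _ e) ?ge_min ?lexx// ltr_pMr// ltr1n.
have d1 : d <= 2^-1 by rewrite ler_pdivrMr// mulVf// ge_min lexx orbT.
have [xl|xg] := leP x 2^-1.
- apply: (h (x + d)); first by apply/andP; split; lra.
    by rewrite -subr_eq0 addrC addKr gt_eqF.
  by rewrite opprD addNKr normrN gtr0_norm.
- apply: (h (x - d)); first by apply/andP; split; lra.
    by rewrite -subr_eq0 addrC addKr oppr_eq0 gt_eqF.
  by rewrite opprB addrC subrK gtr0_norm.
Qed.

Lemma derive01_eq f g x : (forall y, 0 <= y <= 1 -> f y = g y) -> 0 <= x <= 1 ->
  derive01 f x = derive01 g x.
Proof.
move=> fg x01; rewrite /derive01; congr (lim _); rewrite /diffquot01.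
apply/seteqP; split=> P /near_dnbhs01[e e0 h]; apply/near_dnbhs01; exists e => // y y01 yx xy.
  by have := h y y01 yx xy; rewrite /= !fg.
by have := h y y01 yx xy; rewrite /= !fg.
Qed.

(** Away from [x] the difference quotient coincides with the polynomial [q] obtained by dividing
    [p - p(x)] by [X - x], and [q] is continuous. *)
Lemma derive01_poly p x : 0 <= x <= 1 -> derive01 (horner p) x = p^`().[x].
Proof.
move=> x01; have PF := within_dnbhs01_proper x01.
have /factor_theorem[q pq] : root (p - p.[x]%:P) x.
  by rewrite /root !hornerE subrr.
have p'x : p^`().[x] = q.[x].
  have -> : p = q * ('X - x%:P) + p.[x]%:P by rewrite -pq subrK.
  by rewrite derivD derivC addr0 derivM derivXsubC mulr1 !hornerE subrr mulr0 add0r.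
apply/cvg_lim => //; rewrite p'x.
have qx : q.[y] @[y --> within `[0, 1] x^'] --> q.[x].
  apply/cvgrPdist_lt => e e0.
  have /cvgrPdist_lt/(_ e e0)/nbhs_normP[d /= d0 h] := @continuous_horner R q x.
  by apply/near_dnbhs01; exists d => // y _ _ xy; exact: h.
apply: cvg_trans qx; apply: near_eq_cvg; apply/near_dnbhs01; exists 1 => // y _ yx _.
have := congr1 (fun r => r.[y]) pq; rewrite !hornerE => ->.
by rewrite mulfK// subr_eq0.
Qed.

Lemma derive01n_poly s p f : (forall x, 0 <= x <= 1 -> f x = p.[x]) ->
  forall x, 0 <= x <= 1 -> derive01n s f x = p^`(s).[x].
Proof.
move=> fp; elim: s => [//|s IH] x x01.
by rewrite /derive01n iterS -/(derive01n s f) (derive01_eq IH x01) derive01_poly// derivnS.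
Qed.

Lemma derivable01_is_derive f x : 0 < x < 1 -> derivable01 f x ->
  is_derive x 1 f (derive01 f x).
Proof.
move=> /andP[x0 x1] df.
suff cv : h^-1 *: ((f \o shift x) (h *: 1) - f x) @[h --> 0^'] --> derive01 f x.
  by apply: DeriveDef; [apply/cvg_ex; exists (derive01 f x)|exact/cvg_lim].
have {}df : diffquot01 f x --> derive01 f x by [].
apply/cvgrPdist_lt => e e0; move/cvgrPdist_lt: df => /(_ e e0).
move=> /near_dnbhs01[d d0 h]; rewrite /dnbhs near_withinE; apply/nbhs_normP.
(* This radius keeps the increments inside [0, 1], where restricted and ordinary difference
   quotients agree. *)
exists (Num.min d (Num.min x (1 - x))) => /=.
  by rewrite !lt_min d0 x0 subr_gt0.
move=> y /=; rewrite sub0r normrN !lt_min => /and3P[yd yx y1x] y0.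
have /andP[y1 y2] : - `|y| <= y <= `|y| by rewrite -ler_norml.
have := h (y + x).
rewrite /shift/= addrK mulrC; have -> : y *: 1 + x = y + x by rewrite /GRing.scale /= mulr1.
apply.
- by apply/andP; split; lra.
- by rewrite -subr_eq0 addrK.
- by rewrite opprD addrCA subrr addr0 normrN.
Qed.

Lemma derivable01_continuous f : (forall x, x \in `[0, 1] -> derivable01 f x) ->
  {within `[0, 1], continuous f}.
Proof.
move=> df; apply/subspace_continuousP => x x01.
have FF : ProperFilter (within `[0, 1] x^').
  by apply: within_dnbhs01_proper; move: x01; rewrite /= in_itv.
have cv : (f y - f x) / (y - x) @[y --> within `[0, 1] x^'] --> derive01 f x.
  exact: df.
have lin : y - x @[y --> within `[0, 1] x^'] --> 0.
  apply/cvgrPdist_lt => e e0; apply/near_dnbhs01; exists e => // y _ _.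
  by rewrite sub0r opprB.
have h : (f y - f x) / (y - x) * (y - x) @[y --> within `[0, 1] x^'] --> derive01 f x * 0.
  exact: (cvgM cv lin).
move: h; rewrite mulr0 => /cvgrPdist_lt h.
apply/cvgrPdist_lt => e e0; move: (h e e0) => /near_dnbhs01[d d0 {}h].
rewrite near_withinE; apply/nbhs_normP; exists d => //= y xy.
rewrite in_itv /= => y01; have [->|yx] := eqVneq y x; first by rewrite subrr normr0.
have := h y y01 yx xy; rewrite sub0r normrN divfK ?subr_eq0//.
by rewrite distrC.
Qed.

Lemma C01_deriv_tower s f : C01 s f -> deriv_tower01 s (derive01n ^~ f).
Proof.
move=> [df _] i si; split; last by apply: derivable01_continuous; exact: df.
move=> x; rewrite in_itv /= => /andP[x0 x1].
apply: derivable01_is_derive; first by rewrite x0.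
by apply: df => //; rewrite in_itv /= !ltW.
Qed.

Lemma continuous01_bounded f : {within `[0, 1], continuous f} ->
  exists2 M, 0 <= M & forall x, 0 <= x <= 1 -> `|f x| <= M.
Proof.
move=> cf; have [c1 _ h1] := EVT_max ler01 cf; have [c2 _ h2] := EVT_min ler01 cf.
exists (Num.max `|f c1| `|f c2|); first by rewrite le_max normr_ge0.
move=> x x01; have xI : x \in `[0, 1] by rewrite in_itv.
rewrite le_max; apply/orP; case: (leP 0 (f x)) => fx.
- by left; rewrite ger0_norm// (le_trans (h1 x xI))// ler_norm.
- right; rewrite ltr0_norm// (@le_trans _ _ (- f c2)) ?lerN2 ?h2//.
  by rewrite -normrN ler_norm.
Qed.

Lemma poly_bounded01 p : exists2 M, 0 <= M & forall x, 0 <= x <= 1 -> `|p.[x]| <= M.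
Proof. by apply: continuous01_bounded; apply: continuous_subspaceT; exact: continuous_horner. Qed.

End OneSidedDerivatives.

(** * Converse estimates *)

(** Two spare units in [m.+2] allow derivatives of order [s + 1] and [s + 2]; the last bound
    exchanges [1 / m.+2] for [2 / n]. *)
Lemma index_split (s n1 N n : nat) : (4 * s + 2 <= n1)%N -> (n1 <= N <= n)%N ->
  exists m, [/\ n = (s + m.+2)%N, (3 * s + 2 <= m.+2)%N & (n <= 2 * m.+2)%N].
Proof. by move=> h1 h2; exists (n - s.+2)%N; split; lia. Qed.

(* [u i] is the derivative of order [i] of the function [f], [T n] its rounded
   Bernstein polynomial and [a n k * 'C(n, k)] the rounding errors. *)
Section ConverseEstimates.
Context {R : realType} (s n1 : nat) (u : nat -> R -> R) (T : nat -> {poly R})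
  (a : nat -> nat -> R) (alpha C0 A : R).
Context (tu : deriv_tower01 s u).
Context (aC : forall n k, (k <= n)%N -> `|a n k| * 'C(n, k)%:R <= 1).
Context (Ta : forall n, T n = bernf n (u 0%N) - bern n (a n)).
Context (al0 : 0 < alpha) (al1 : alpha < 1) (C00 : 0 <= C0) (sn1 : (4 * s + 2 <= n1)%N).
Context (app : forall n x, (n1 <= n)%N -> 0 <= x <= 1 ->
  `|u s x - (T n)^`(s).[x]| <= C0 * n%:R `^ (- alpha)).
Context (TA : forall n x, (n1 <= n)%N -> 0 <= x <= 1 -> `|(T n)^`(s).[x]| <= A).

Let n10 : (0 < n1)%N.
Proof. by apply: leq_trans sn1; rewrite addn2. Qed.

Let w N i x := u i x - (T N)^`(i).[x].

Let tw N : deriv_tower01 s (w N).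
Proof. by apply: deriv_tower01B => //; exact: deriv_tower01_poly. Qed.

Let D n k := (n ^_ s)%:R * iter s fdiff (a n) k.

Let Tdecomp n N : T n =
  bernf n (w N 0%N) + bernf n (horner (T N)) - bern n (a n).
Proof. by rewrite {1}Ta -bernD; congr (_ - _); apply: eq_bern => k _; rewrite /w subrK. Qed.

Let pow_le N n : (n1 <= N <= n)%N -> n%:R `^ (- alpha) <= N%:R `^ (- alpha).
Proof.
move=> /andP[n1N Nn]; have N0 : (0 < N)%N by exact: leq_trans n1N.
have n0 : (0 < n)%N by exact: leq_trans Nn.
rewrite !powRN lef_pV2 ?posrE ?powR_gt0 ?ltr0n//.
by apply: ge0_ler_powR; rewrite ?nnegrE ?(ltW al0)// ler_nat.
Qed.

Let inv_le_pow n : (0 < n)%N -> n%:R^-1 <= n%:R `^ (- alpha).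
Proof.
move=> n0; rewrite -powR_inv1// ler_powR ?ler1n// lerN2; exact: ltW.
Qed.

Lemma error_coef_le : exists2 C1, 0 <= C1 & forall n N theta,
  (n1 <= N <= n)%N -> (forall x, 0 <= x <= 1 -> `|(T N)^`(s.+1).[x]| <= theta) ->
  forall k, (k <= n - s)%N -> `|D n k| <= C1 * (N%:R `^ (- alpha) + theta / n%:R).
Proof.
have [C hC0 hC] := rounding_coef_bound (R := R) s.
pose K := 3 * C0 + 2 * ((s ^ 2)%:R * A + 1).
have o01 : 0 <= (0 : R) <= 1 by rewrite lexx ler01.
have A0 : 0 <= A := le_trans (normr_ge0 _) (TA (leqnn n1) o01).
have K0 : 0 <= K by rewrite addr_ge0 ?mulr_ge0 ?addr_ge0 ?mulr_ge0.
exists (C * (K + 2 * (2 * s + 1)%:R)); first by apply: mulr_ge0 => //; apply: addr_ge0.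
move=> n N theta /[dup] nN /andP[n1N Nn] hth k kn.
have th0 : 0 <= theta := le_trans (normr_ge0 _) (hth 0 o01).
have [m' [nE sm n2m]] := index_split sn1 nN; set m := m'.+2 in nE sm n2m.
have n0 : (0 < n)%N by rewrite nE addnS.
have mR0 : 0 < m%:R :> R by rewrite ltr0n.
have nR0 : 0 < n%:R :> R by rewrite ltr0n.
have im : m%:R^-1 <= 2 * n%:R^-1 :> R.
  by rewrite -[2]invrK -invfM lef_pV2 ?posrE ?mulr_gt0 ?invr_gt0// ler_pdivrMl// -natrM ler_nat.
have km : (k <= m)%N by rewrite nE addKn in kn.
set p := N%:R `^ (- alpha).
have p0 : 0 <= p by exact: powR_ge0.
have np : n%:R `^ (- alpha) <= p by exact: pow_le.
pose eta := 3 * (C0 * p) + ((s ^ 2)%:R * A + (2 * s + 1)%:R * theta) / m%:R.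
have := hC m (a n) eta sm _ _ k km; rewrite -nE => /(_ (aC (n := n))) h.
apply: le_trans (h _) _.
  move=> x x01 xm.
  (* Every difference is now controlled: the first and the two last terms by [C0 p] each, whence the
     3 in [eta], and the second by [derivn_bernf_poly_near]. *)
  have -> : (bern n (a n))^`(s).[x] = (bernf n (w N 0%N))^`(s).[x] +
      ((bernf n (horner (T N)))^`(s).[x] - (T N)^`(s).[x]) -
      (u s x - (T N)^`(s).[x]) + (u s x - (T n)^`(s).[x]).
    have -> : bern n (a n) = bernf n (w N 0%N) + bernf n (horner (T N)) - T n.
      by rewrite [in RHS](Tdecomp n N) subKr.
    by rewrite derivnB derivnD hornerD hornerN hornerD; ring.
  have e1 : `|(bernf n (w N 0%N))^`(s).[x]| <= C0 * p.
    rewrite nE; apply: norm_derivn_bernf_le => //; first by rewrite -nE.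
    by move=> y y01; exact: app.
  have e2 : `|(bernf n (horner (T N)))^`(s).[x] - (T N)^`(s).[x]| <=
      ((s ^ 2)%:R * A + (2 * s + 1)%:R * theta) / m%:R.
    by rewrite nE; apply: derivn_bernf_poly_near => // y y01; exact: TA.
  have e3 : `|u s x - (T N)^`(s).[x]| <= C0 * p by exact: app.
  have e4 : `|u s x - (T n)^`(s).[x]| <= C0 * p.
    by apply: le_trans (app (leq_trans n1N Nn) x01) (ler_wpM2l C00 np).
  apply: le_trans (ler_normD _ _) _; apply: le_trans (lerD (ler_normB _ _) e4) _.
  have := ler_normD (bernf n (w N 0%N))^`(s).[x]
    ((bernf n (horner (T N)))^`(s).[x] - (T N)^`(s).[x]).
  rewrite /eta; lra.
rewrite -mulrA ler_wpM2l//.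
have np' : n%:R^-1 <= p by apply: le_trans np; exact: inv_le_pow.
have B0 : 0 <= (s ^ 2)%:R * A + (2 * s + 1)%:R * theta + 1.
  by rewrite !addr_ge0 ?mulr_ge0.
have -> : eta + m%:R^-1 = 3 * (C0 * p) +
   ((s ^ 2)%:R * A + (2 * s + 1)%:R * theta + 1) * m%:R^-1 by rewrite /eta; ring.
apply: le_trans (lerD (lexx _) (ler_wpM2l B0 im)) _.
have q0 : 0 <= ((s ^ 2)%:R * A + 1) * (p - n%:R^-1).
  by rewrite mulr_ge0 ?subr_ge0 ?addr_ge0 ?mulr_ge0.
have q1 : 0 <= (2 * s + 1)%:R * p by rewrite mulr_ge0.
have q2 : 0 <= K * (theta / n%:R) by rewrite mulr_ge0 ?divr_ge0// ltW.
rewrite -subr_ge0.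
have -> : (K + 2 * (2 * s + 1)%:R) * (p + theta / n%:R) - (3 * (C0 * p) +
    ((s ^ 2)%:R * A + (2 * s + 1)%:R * theta + 1) * (2 * n%:R^-1)) =
    2 * (((s ^ 2)%:R * A + 1) * (p - n%:R^-1)) + 2 * ((2 * s + 1)%:R * p) + K * (theta / n%:R).
  by rewrite /K; ring.
by rewrite !addr_ge0// mulr_ge0.
Qed.

(** In the recursive factor [1 + 2 * C1], the 1 comes from the Bernstein operator not increasing the
    seminorm, and [2 * C1] from the share [theta / n] of the rounding coefficients, multiplied by
    [2 n] on differentiation. *)
Lemma deriv_growth : exists2 M, 0 <= M & forall n x, (n1 <= n)%N -> 0 <= x <= 1 ->
  `|(T n)^`(s.+1).[x]| <= M * n%:R `^ (1 - alpha).
Proof.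
have [C1 C10 hC1] := error_coef_le.
suff : exists2 M, 0 <= M & forall n, (n1 <= n)%N -> forall x, 0 <= x <= 1 ->
    `|(T n)^`(s.+1).[x]| <= M * n%:R `^ (1 - alpha).
  by move=> [M M0 hM]; exists M => // n x n1n; exact: hM.
apply: (@powR_recurrence _ (fun n t => forall x, 0 <= x <= 1 -> `|(T n)^`(s.+1).[x]| <= t)
  n1 alpha (1 + 2 * C1) (2 * C0 + 2 * C1)) => //.
- by rewrite addr_ge0 ?mulr_ge0.
- by rewrite addr_ge0 ?mulr_ge0.
- by move=> n b c h bc x x01; exact: le_trans (h x x01) bc.
- by move=> n _; have [M _ hM] := poly_bounded01 (T n)^`(s.+1); exists M.
move=> n N theta /[dup] nN /andP[n1N Nn] hth x x01.
have [m' [nE _ _]] := index_split sn1 nN; set m := m'.+1 in nE.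
have n0 : (0 < n)%N by rewrite nE addnS.
have th0 : 0 <= theta by rewrite (le_trans _ (hth x x01)).
have mn : m.+1%:R <= n%:R :> R by rewrite ler_nat nE leq_addl.
set p := N%:R `^ (- alpha).
have p0 : 0 <= p by exact: powR_ge0.
have nR0 : 0 < n%:R :> R by rewrite ltr0n.
rewrite (Tdecomp n N) derivnB derivnD hornerD hornerN hornerD.
have e1 : `|(bernf n (w N 0%N))^`(s.+1).[x]| <= 2 * n%:R * (C0 * p).
  apply: (@le_trans _ _ (2 * m.+1%:R * (C0 * p))).
    rewrite nE; apply: norm_derivnS_bernf_le => //; first by rewrite -nE.
    by move=> y y01; exact: app.
  by rewrite ler_wpM2r ?mulr_ge0// ler_wpM2l.
have e2 : `|(bernf n (horner (T N)))^`(s.+1).[x]| <= theta.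
  rewrite nE -addSnnS.
  apply: (@norm_derivn_bernf_le _ s.+1 m (fun i => horner (T N)^`(i))) => //.
  exact: deriv_tower01_poly.
have e3 : `|(bern n (a n))^`(s.+1).[x]| <= 2 * n%:R * (C1 * (p + theta / n%:R)).
  have -> : (bern n (a n))^`(s.+1) = (bern m.+1 (D n))^`().
    by rewrite derivnS [in LHS]nE derivn_bern -bernZ /D -nE.
  apply: (@le_trans _ _ (2 * m.+1%:R * (C1 * (p + theta / n%:R)))).
    by apply: norm_deriv_bern_le => // k km; apply: hC1 => //; rewrite nE addKn.
  by rewrite ler_wpM2r ?mulr_ge0 ?addr_ge0 ?divr_ge0 ?ler_wpM2l// ltW.
apply: le_trans (ler_normB _ _) _; apply: le_trans (lerD (ler_normD _ _) e3) _.
apply: le_trans (lerD (lerD e1 e2) (lexx _)) _.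
rewrite le_eqVlt; apply/orP; left; apply/eqP; field; exact: lt0r_neq0.
Qed.

(** With [N = n] and the growth just obtained, [theta / n] is itself of order [n ^ -alpha]. *)
Lemma error_coef_rate : exists2 C2, 0 <= C2 & forall n k,
  (n1 <= n)%N -> (k <= n - s)%N -> `|D n k| <= C2 * n%:R `^ (- alpha).
Proof.
have [C1 C10 hC1] := error_coef_le; have [M M0 hM] := deriv_growth.
exists (C1 * (1 + M)); first by rewrite mulr_ge0// addr_ge0.
move=> n k n1n kn.
have nR0 : 0 < n%:R :> R by rewrite ltr0n (leq_trans n10).
have nn : (n1 <= n <= n)%N by rewrite n1n leqnn.
apply: le_trans (hC1 n n _ nn (fun x => hM n x n1n) k kn) _.
rewrite -powR_mul_neg// le_eqVlt; apply/orP; left; apply/eqP; field; exact: lt0r_neq0.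
Qed.

(** The rounding term is bounded outright by [error_coef_rate], so only the Bernstein image of [T N]
    feeds the weighted seminorm back into the recurrence. *)
Lemma phi_deriv2_growth : exists2 M, 0 <= M & forall n x, (n1 <= n)%N -> 0 <= x <= 1 ->
  x * (1 - x) * `|(T n)^`(s.+2).[x]| <= M * n%:R `^ (1 - alpha).
Proof.
have [C2 C20 hC2] := error_coef_rate.
suff : exists2 M, 0 <= M & forall n, (n1 <= n)%N -> forall x, 0 <= x <= 1 ->
    x * (1 - x) * `|(T n)^`(s.+2).[x]| <= M * n%:R `^ (1 - alpha).
  by move=> [M M0 hM]; exists M => // n x n1n; exact: hM.
apply: (@powR_recurrence _ (fun n t => forall x, 0 <= x <= 1 ->
    x * (1 - x) * `|(T n)^`(s.+2).[x]| <= t)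
  n1 alpha (4 * s.+2%:R) (4 * C0 + 4 * C2)) => //.
- by rewrite addr_ge0 ?mulr_ge0.
- by move=> n b c h bc x x01; exact: le_trans (h x x01) bc.
- move=> n _; have [M M0 hM] := poly_bounded01 (T n)^`(s.+2); exists M => x x01.
  rewrite -[M]mul1r ler_pM ?hM//.
    by case/andP: x01 => *; rewrite mulr_ge0 ?subr_ge0.
  by case/andP: x01 => x0 x1; rewrite mulr_ile1 ?subr_ge0 ?gerBl.
move=> n N psi /[dup] nN /andP[n1N Nn] hpsi x x01.
have [m [nE _ _]] := index_split sn1 nN.
have n0 : (0 < n)%N by rewrite nE addnS.
have mn : m.+2%:R <= n%:R :> R by rewrite ler_nat nE leq_addl.
set p := N%:R `^ (- alpha).
have p0 : 0 <= p by exact: powR_ge0.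
have np : n%:R `^ (- alpha) <= p by exact: pow_le.
have phi0 : 0 <= x * (1 - x) by case/andP: x01 => *; rewrite mulr_ge0 ?subr_ge0.
rewrite (Tdecomp n N) derivnB derivnD hornerD hornerN hornerD.
have e1 : x * (1 - x) * `|(bernf n (w N 0%N))^`(s.+2).[x]| <= 4 * n%:R * (C0 * p).
  apply: (@le_trans _ _ (4 * m.+2%:R * (C0 * p))).
    rewrite nE; apply: phi_derivnSS_bernf_le => //; first by rewrite -nE.
    by move=> y y01; exact: app.
  by rewrite ler_wpM2r ?mulr_ge0// ler_wpM2l.
have e2 : x * (1 - x) * `|(bernf n (horner (T N)))^`(s.+2).[x]| <= 4 * s.+2%:R * psi.
  by rewrite nE -!addSnnS; apply: phi_derivn_bernf_poly_le.
have e3 : x * (1 - x) * `|(bern n (a n))^`(s.+2).[x]| <= 4 * n%:R * (C2 * p).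
  have -> : (bern n (a n))^`(s.+2) = (bern m.+2 (D n))^`(2).
    by rewrite !derivnS [in LHS]nE derivn_bern -bernZ /D -nE.
  apply: (@le_trans _ _ (4 * m.+2%:R * (C2 * p))).
    apply: phi_deriv2_bern_le => // k km.
    apply: le_trans (hC2 n k (leq_trans n1N Nn) _) (ler_wpM2l C20 np).
    by rewrite nE addKn.
  by rewrite ler_wpM2r ?mulr_ge0// ler_wpM2l.
apply: le_trans (ler_wpM2l phi0 (le_trans (ler_normB _ _) (lerD (ler_normD _ _) (lexx _)))) _.
rewrite [leLHS]mulrDr [X in X + _ <= _]mulrDr; apply: le_trans (lerD (lerD e1 e2) e3) _.
rewrite le_eqVlt; apply/orP; left; apply/eqP; ring.
Qed.

End ConverseEstimates.

(** * From approximation rates to moduli of smoothness *)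

Section Moduli.
Context {R : realType}.
Implicit Types t h x y : R.

(** For [n] the integer part of [1 / t], the product [n t] lies between 1/2 and 1; the factor 2
    comes from [(1/2) ^ alpha >= 1/2]. *)
Lemma scale_index t (alpha : R) (n1 : nat) : 0 < alpha -> alpha < 1 -> (0 < n1)%N ->
  0 < t -> t <= n1%:R^-1 ->
  exists n, [/\ (n1 <= n)%N, n%:R `^ (- alpha) <= 2 * t `^ alpha &
    t * n%:R `^ (1 - alpha) <= t `^ alpha].
Proof.
move=> al0 al1 n10 t0 tn.
have it0 : 0 < t^-1 by rewrite invr_gt0.
have n1t : n1%:R <= t^-1 by rewrite -[leLHS]invrK lef_pV2 ?posrE ?invr_gt0 ?ltr0n.
pose n := Num.truncn t^-1.
have /andP[nt tn'] : n%:R <= t^-1 < n.+1%:R by apply: truncn_itv; exact: ltW.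
have n1n : (n1 <= n)%N by rewrite -ltnS -(ltr_nat R); exact: le_lt_trans tn'.
have n0 : (0 < n)%N by exact: leq_trans n1n.
have nR0 : 0 < n%:R :> R by rewrite ltr0n.
exists n; split => //.
- rewrite powRN -ler_pdivrMr ?powR_gt0// -[leLHS]invfM -[2]invrK lef_pV2; last 2 first.
  + by rewrite posrE mulr_gt0 ?powR_gt0.
  + by rewrite posrE invr_gt0.
  rewrite -powRM ?(ltW t0) ?(ltW nR0)//.
  have h : 2^-1 <= n%:R * t.
    rewrite -ler_pdivrMr// (le_trans _ (_ : n.+1%:R / 2 <= _))//.
      by rewrite mulrC ler_pM2r ?invr_gt0// ltW.
    by rewrite ler_pdivrMr// -natrM ler_nat muln2 -addnn -addn1 leq_add2l.
  apply: (@le_trans _ _ (2^-1 `^ alpha)); last first.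
    by apply: ge0_ler_powR; rewrite ?nnegrE ?mulr_ge0 ?invr_ge0 ?(ltW al0) ?(ltW t0).
  apply: ger1_powR; rewrite ?(ltW al1)// invr_gt0 ltr0n /= invf_le1//.
  by rewrite ler1n.
- rewrite -[X in _ <= _ `^ X](subKr 1 alpha) -(powR_mul_neg (1 - alpha) t0) ler_wpM2l ?(ltW t0)//.
  have -> : t `^ (- (1 - alpha)) = t^-1 `^ (1 - alpha).
    by rewrite -(powR_inv1 (ltW t0)) -powRrM mulN1r.
  by apply: ge0_ler_powR; rewrite ?nnegrE ?invr_ge0 ?subr_ge0 ?(ltW al1) ?(ltW t0).
Qed.

Context (F : R -> R) (G : nat -> {poly R}) (n1 : nat) (alpha C0 M : R).
Context (al0 : 0 < alpha) (al1 : alpha < 1) (n10 : (0 < n1)%N) (C00 : 0 <= C0) (M0 : 0 <= M).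
Context (FG : forall n x, (n1 <= n)%N -> 0 <= x <= 1 ->
  `|F x - (G n).[x]| <= C0 * n%:R `^ (- alpha)).

Lemma diff_le_of_approx t x y :
  (forall n x, (n1 <= n)%N -> 0 <= x <= 1 ->
    `|(G n)^`().[x]| <= M * n%:R `^ (1 - alpha)) ->
  0 < t -> t <= n1%:R^-1 -> 0 <= x <= 1 -> 0 <= y <= 1 -> `|x - y| <= t ->
  `|F x - F y| <= (4 * C0 + M) * t `^ alpha.
Proof.
move=> hG t0 tn x01 y01 xyt.
have [n [n1n e1 e2]] := scale_index al0 al1 n10 t0 tn.
have hx := FG n1n x01; have hy := FG n1n y01.
have hxy := poly_lipschitz (fun z z01 => hG n z n1n z01) x01 y01.
have -> : F x - F y = (F x - (G n).[x]) - (F y - (G n).[y]) + ((G n).[x] - (G n).[y]) by ring.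
apply: le_trans (ler_normD _ _) _; apply: le_trans (lerD (ler_normB _ _) hxy) _.
have h3 : M * n%:R `^ (1 - alpha) * `|x - y| <= M * t `^ alpha.
  rewrite -mulrA ler_wpM2l// (le_trans _ e2)// mulrC ler_wpM2r// powR_ge0.
have h4 := ler_wpM2l C00 e1.
by move: (t `^ alpha) (n%:R `^ (- alpha)) h3 h4 hx hy => p q h3 h4 hx hy; lra.
Qed.

(** The index is chosen for the scale [h ^ 2]. Since [d ^ 2 = h ^ 2 x (1 - x)], the weight cancels
    [1 / x + 1 / (1 - x)] in the polynomial estimate. *)
Lemma symdiff2_le_of_approx h x :
  (forall n x, (n1 <= n)%N -> 0 <= x <= 1 ->
    x * (1 - x) * `|(G n)^`(2).[x]| <= M * n%:R `^ (1 - alpha)) ->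
  0 < h -> h ^+ 2 <= n1%:R^-1 -> 0 <= x <= 1 ->
  `|symdiff2 F h x| <= (8 * C0 + 2 * M) * h `^ (2 * alpha).
Proof.
move=> hG h0 hn x01; have K0 : 0 <= 8 * C0 + 2 * M by rewrite addr_ge0 ?mulr_ge0.
rewrite /symdiff2; case: ifPn => [|_]; last by rewrite normr0 mulr_ge0// powR_ge0.
set d := h * phi x; rewrite !in_itv /= => /andP[/andP[_ xd1] /andP[xd0 _]].
have /andP[x0 x1] := x01.
have p0 : 0 <= x * (1 - x) by rewrite mulr_ge0 ?subr_ge0.
have d2 : d ^+ 2 = h ^+ 2 * (x * (1 - x)) by rewrite exprMn sqr_sqrtr.
have [d0|dpos] := leP d 0.
  have -> : d = 0 by apply/eqP; rewrite eq_le d0 mulr_ge0 ?sqrtr_ge0// ltW.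
  rewrite addr0 subr0; have -> : F x - 2 * F x + F x = 0 by ring.
  by rewrite normr0 mulr_ge0// powR_ge0.
have dx : d <= x by rewrite -subr_ge0.
have h20 : 0 < h ^+ 2 by rewrite exprn_gt0.
have [n [n1n e1 e2]] := scale_index al0 al1 n10 h20 hn.
have xpos : 0 < x by exact: lt_le_trans dx.
have x1pos : 0 < 1 - x by rewrite subr_gt0 (lt_le_trans _ xd1)// ltrDl.
have hd := symdiff2_poly_le (fun z z01 => hG n z n1n z01) dpos dx xd1.
have {}hd : `|(G n).[x + d] - 2 * (G n).[x] + (G n).[x - d]| <=
    2 * M * (h ^+ 2 * n%:R `^ (1 - alpha)).
  apply: le_trans hd _; rewrite d2 le_eqVlt; apply/orP; left; apply/eqP.
  by field; rewrite !lt0r_neq0.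
have hp := FG n1n (_ : 0 <= x + d <= 1); have hm := FG n1n (_ : 0 <= x - d <= 1).
have {}hp : `|F (x + d) - (G n).[x + d]| <= C0 * n%:R `^ (- alpha).
  by apply: hp; rewrite xd1 andbT addr_ge0// ltW.
have {}hm : `|F (x - d) - (G n).[x - d]| <= C0 * n%:R `^ (- alpha).
  by apply: hm; rewrite xd0 /= lerBlDr (le_trans x1)// lerDl ltW.
have h0' := FG n1n x01.
have -> : F (x + d) - 2 * F x + F (x - d) = (F (x + d) - (G n).[x + d]) -
    2 * (F x - (G n).[x]) + (F (x - d) - (G n).[x - d]) +
    ((G n).[x + d] - 2 * (G n).[x] + (G n).[x - d]) by ring.
apply: le_trans (ler_normD _ _) _; apply: le_trans (lerD (ler_normD _ _) hd) _.
apply: le_trans (lerD (lerD (ler_normB _ _) hm) (lexx _)) _.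
rewrite normrM normr_nat powRrM powR_mulrn ?(ltW h0)//.
have h4 := ler_wpM2l C00 e1; have h5 := ler_wpM2l M0 e2.
move: ((h ^+ 2) `^ alpha) (n%:R `^ (- alpha)) (h ^+ 2 * _) h4 h5 hp h0' => p q v h4 h5 hp h0'.
by clear - h4 h5 hp h0'; lra.
Qed.

End Moduli.

(** * Rounded Bernstein operators and the converse theorem *)

Section RoundedBernstein.
Context {R : realType}.
Implicit Types (f : R -> R) (r : R -> int) (n k s : nat).

(** Dividing by ['C(n, k)] compensates the binomial factor contained in [bernp]. *)
Definition bernint r n f : {poly R} :=
  bern n (fun k => (r (f (k%:R / n%:R) * 'C(n, k)%:R))%:~R / 'C(n, k)%:R).

Lemma bernstein_intE r n f x : bernstein_int r n f x = (bernint r n f).[x].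
Proof.
rewrite horner_bern; apply: eq_bigr => k _; rewrite horner_bernp.
by field; rewrite pnatr_eq0 -lt0n bin_gt0 leq_ord.
Qed.

Lemma bernint_rounding r n f k : (forall b, `|b - (r b)%:~R| <= 1) -> (k <= n)%N ->
  `|f (k%:R / n%:R) - (r (f (k%:R / n%:R) * 'C(n, k)%:R))%:~R / 'C(n, k)%:R| *
    'C(n, k)%:R <= 1.
Proof.
move=> hr kn; have c0 : 0 < 'C(n, k)%:R :> R by rewrite ltr0n bin_gt0.
rewrite -[X in _ * X](gtr0_norm c0) -normrM mulrBl divfK ?gt_eqF//.
Qed.

Lemma norm_sup_le (E : set R) (B : R) : E !=set0 ->
  (forall e, E e -> 0 <= e <= B) -> `|sup E| <= B.
Proof.
move=> E0 hE; have ubE : ubound E B by move=> e /hE/andP[].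
have [e Ee] := E0; have /andP[e0 _] := hE e Ee.
have es : e <= sup E by apply: ub_le_sup => //; exists B.
by rewrite ger0_norm ?(le_trans e0 es)// ge_sup.
Qed.

(** The value of [B] is immaterial: it certifies that the set is bounded, so that [sup] really is an
    upper bound. *)
Lemma norm_le_supnorm01 (g : R -> R) (B : R) x :
  (forall y, 0 <= y <= 1 -> `|g y| <= B) -> 0 <= x <= 1 -> `|g x| <= supnorm01 g.
Proof.
move=> gB x01; apply: ub_le_sup.
  by exists B => _ [y /= yI <-]; apply: gB; move: yI; rewrite in_itv.
by exists x => //=; rewrite in_itv.
Qed.

Lemma supnorm01_le (g : R -> R) (B : R) :
  (forall x, 0 <= x <= 1 -> `|g x| <= B) -> 0 <= supnorm01 g <= B.
Proof.
move=> gB; have o01 : 0 <= (0 : R) <= 1 by rewrite lexx ler01.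
rewrite (le_trans (normr_ge0 (g 0)) (norm_le_supnorm01 gB o01))/=.
apply: ge_sup; first by exists `|g 0|, 0 => //=; rewrite in_itv.
by move=> _ [y /= yI <-]; apply: gB; move: yI; rewrite in_itv.
Qed.

Lemma converse_rounded_bernstein (s : nat) (alpha : R) f r :
  0 < alpha -> alpha < 1 -> C01 s f -> (forall b, `|b - (r b)%:~R| <= 1) ->
  (fun n : nat => supnorm01 (derive01n s (bernstein_int r n f) \- derive01n s f))
    =O_ \oo (fun n : nat => n%:R `^ (- alpha)) ->
  (fun h : R => omega2phi (derive01n s f) h)
    =O_ (0^'+) (fun h : R => h `^ (2 * alpha)) /\
  (fun h : R => omega1 (derive01n s f) h) =O_ (0^'+) (fun h : R => h `^ alpha).
Proof.
move=> al0 al1 hf hr /eqO_exP[C0 C0pos [n0 _ hn0]].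
have C00 := ltW C0pos.
pose T n := bernint r n f; set F := derive01n s f.
have [MF MF0 hMF] : exists2 M, 0 <= M & forall x, 0 <= x <= 1 -> `|F x| <= M.
  exact: continuous01_bounded hf.2.
pose a n k := f (k%:R / n%:R) - (r (f (k%:R / n%:R) * 'C(n, k)%:R))%:~R / 'C(n, k)%:R.
have aC n k : (k <= n)%N -> `|a n k| * 'C(n, k)%:R <= 1 by exact: bernint_rounding.
have Ta n : T n = bernf n f - bern n (a n).
  by rewrite -bernB; apply: eq_bern => k _; rewrite /a subKr.
pose n1 := maxn n0 (4 * s + 2).
have sn1 : (4 * s + 2 <= n1)%N by exact: leq_maxr.
have n10 : (0 < n1)%N by apply: leq_trans sn1; rewrite addn2.
have app n x : (n1 <= n)%N -> 0 <= x <= 1 ->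
    `|F x - (T n)^`(s).[x]| <= C0 * n%:R `^ (- alpha).
  move=> n1n x01; have n0n : (n0 <= n)%N by apply: leq_trans n1n; exact: leq_maxl.
  have := hn0 n n0n; rewrite /= [X in _ <= _ * X]ger0_norm ?powR_ge0//.
  apply: le_trans; apply: le_trans (ler_norm _).
  have e y : 0 <= y <= 1 -> (derive01n s (bernstein_int r n f) \- derive01n s f) y =
      (T n)^`(s).[y] - F y.
    by move=> y01 /=; rewrite (@derive01n_poly _ s (T n))// => z _; exact: bernstein_intE.
  have [MT MT0 hMT] := poly_bounded01 (T n)^`(s).
  rewrite distrC -e//; apply: (@norm_le_supnorm01 _ (MT + MF)) => // y y01.
  by rewrite e// (le_trans (ler_normB _ _))// lerD ?hMT ?hMF.
have TA n x : (n1 <= n)%N -> 0 <= x <= 1 -> `|(T n)^`(s).[x]| <= MF + C0.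
  move=> n1n x01; rewrite -[_.[x]](subKr (F x)) (le_trans (ler_normB _ _))// lerD ?hMF//.
  apply: le_trans (app n x n1n x01) _; rewrite ler_piMr// powRN invf_le1 ?powR_gt0 ?ltr0n ?(leq_trans n10)//.
  by rewrite -[leLHS](powRr0 (n%:R : R)) ler_powR ?ler1n ?(leq_trans n10)// ltW.
have tu := C01_deriv_tower hf.
have [M1 M10 hM1] := deriv_growth tu aC Ta al0 al1 C00 sn1 app TA.
have [M2 M20 hM2] := phi_deriv2_growth tu aC Ta al0 al1 C00 sn1 app TA.
have in1 : 0 < n1%:R^-1 :> R by rewrite invr_gt0 ltr0n.
split; apply/eqO_exP.
  (* The added 1 makes the constant strictly positive, as [eqO_exP] demands. *)
  exists (8 * C0 + 2 * M2 + 1); first by rewrite ltr_wpDl ?addr_ge0 ?mulr_ge0.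
  near=> h.
  have h0 : 0 < h by near: h; exact: nbhs_right_gt.
  have hs : h <= Num.sqrt n1%:R^-1 by near: h; apply: nbhs_right_le; rewrite sqrtr_gt0.
  rewrite [X in _ <= _ * X]ger0_norm ?powR_ge0//.
  apply: (@le_trans _ _ ((8 * C0 + 2 * M2) * h `^ (2 * alpha))); last first.
    by rewrite ler_wpM2r ?powR_ge0// lerDl.
  apply: norm_sup_le; first by exists (supnorm01 (symdiff2 F h)), h => //=; rewrite in_itv /= h0 lexx.
  move=> _ [t /= + <-]; rewrite in_itv /= => /andP[t0 th].
  apply: supnorm01_le => x x01.
  apply: le_trans (symdiff2_le_of_approx al0 al1 n10 C00 M20 app hM2 t0 _ x01) _.
    rewrite -[n1%:R^-1]sqr_sqrtr ?(ltW in1)// lerXn2r ?nnegrE ?sqrtr_ge0 ?(ltW t0)//.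
    exact: le_trans hs.
  rewrite ler_wpM2l ?addr_ge0 ?mulr_ge0//; apply: ge0_ler_powR => //.
  - by rewrite mulr_ge0// ltW.
  - by rewrite nnegrE ltW.
  - by rewrite nnegrE ltW.
exists (4 * C0 + M1 + 1); first by rewrite ltr_wpDl ?addr_ge0 ?mulr_ge0.
near=> h.
have h0 : 0 < h by near: h; exact: nbhs_right_gt.
have hs : h <= n1%:R^-1 by near: h; exact: nbhs_right_le.
rewrite [X in _ <= _ * X]ger0_norm ?powR_ge0//.
apply: (@le_trans _ _ ((4 * C0 + M1) * h `^ alpha)); last first.
  by rewrite ler_wpM2r ?powR_ge0// lerDl.
apply: norm_sup_le.
  exists `|F 0 - F 0|, (0, 0) => //=; split; rewrite ?in_itv /= ?lexx ?ler01//.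
  by rewrite subrr normr0 ltW.
move=> _ [[x y] /= [xI yI xyh] <-]; rewrite normr_ge0 /=.
move: xI yI; rewrite !in_itv /= => x01 y01.
exact: (diff_le_of_approx al0 al1 n10 C00 M10 app hM1).
Unshelve. all: by end_near.
Qed.

End RoundedBernstein.

Theorem theorem1p1 (R : realType) (s : nat) (alpha : R) (f : R -> R)
    (r : R -> int)
    (hs : (0 < s)%N) (halpha0 : 0 < alpha) (halpha1 : alpha < 1)
    (hf : C01 s f) (hf0 : f 0 \is a Num.int) (hf1 : f 1 \is a Num.int)
    (hr : nearest_int r)
    (happrox :
      (fun n : nat => supnorm01
         (derive01n s (bernstein_floor n f) \- derive01n s f))
        =O_ \oo (fun n : nat => n%:R `^ (- alpha))
      \/
      (fun n : nat => supnorm01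
         (derive01n s (bernstein_int r n f) \- derive01n s f))
        =O_ \oo (fun n : nat => n%:R `^ (- alpha))) :
  (fun h : R => omega2phi (derive01n s f) h)
    =O_ (0^'+) (fun h : R => h `^ (2 * alpha))
  /\
  (fun h : R => omega1 (derive01n s f) h)
    =O_ (0^'+) (fun h : R => h `^ alpha).
Proof.
have floor1 (b : R) : `|b - (Num.floor b)%:~R| <= 1.
  by rewrite ger0_norm ?subr_ge0 ?ge_floor// lerBlDl ltW// -intrD1 floorD1_gt.
case: happrox => h; apply: (converse_rounded_bernstein halpha0 halpha1 hf _ h) => // b.
(* A nearest integer is at least as close as the floor, so both roundings err by at most 1. *)
exact: le_trans (hr b (Num.floor b)) (floor1 b).
Qed.
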